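(* Let $n\geqslant4$, let $\Gamma$ be an admissible graph with $n$ half-edges and let $(\ell_i)_{i=1,\dots,n}$ be a family of positive real numbers such that $\ell_j<\frac12(\ell_1+\cdots+\ell_n)$ for every $j$. The image of the map $$\lambda:\mathcal M_\ell\to\mathbb R^{E_{\mathrm{int}}(\Gamma)},\qquad x\mapsto(\lambda_a(x))_a$$ is the polyhedron $\Delta(\ell,\Gamma)$. The fibers of $\lambda$ are connected. Denote by $\operatorname{Int}\Delta(\ell,\Gamma)$ the interior of $\Delta(\ell,\Gamma)$. Then the set $\mathcal M^{\mathrm{reg}}_{\ell,\Gamma}:=\lambda^{-1}(\operatorname{Int}\Delta(\ell,\Gamma))$ is open and dense in $\mathcal M_\ell$ and included in $\mathcal M^*_{\ell,\Gamma}$. For any $x\in\mathcal M^{\mathrm{reg}}_{\ell,\Gamma}$, the differentials $d_x\lambda_a$, $a\in E_{\mathrm{int}}(\Gamma)$, are linearly independent.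
   Context: $\mathfrak{su}(2)$ has the scalar product $\langle\xi,\eta\rangle=-\frac12\operatorname{tr}(\xi\eta)$; $S^2_m\subset\mathfrak{su}(2)^*$ is the sphere of radius $m$ centered at the origin, with its coadjoint orbit symplectic structure. The polygon space is $$\mathcal M_\ell=\{(x_1,\dots,x_n)\in S^2_{\ell_1}\times\cdots\times S^2_{\ell_n}\,/\;x_1+\cdots+x_n=0\}/SU(2)$$ (diagonal coadjoint action). $S_\ell\subset\mathcal M_\ell$ is the finite set of classes $[x_1,\dots,x_n]$ such that all the $x_i$ belong to the same line; $\mathcal M_\ell\setminus S_\ell$ is a symplectic manifold of dimension $2(n-3)$. An admissible graph is a connected, acyclic, trivalent graph, where edges with only one endpoint (half-edges) are permitted; the other edges are called internal edges. The half-edges are numbered $1,\dots,n$. $E_{\mathrm{int}}(\Gamma)$ and $E(\Gamma)$ are the sets of internal edges and of all edges. For an internal edge $a$, choose a direction and let $I(a)$ be the set of half-edges connected to the initial vertex of $a$ by a path not containing the terminal vertex of $a$. The function $\lambda_a([x_1,\dots,x_n])=|\sum_{i\in I(a)}x_i|$ does not depend on the direction. $\mathcal M^*_{\ell,\Gamma}$ is the subset of $\mathcal M_\ell\setminus S_\ell$ where none of the functions $\lambda_a$ vanishes. $\Delta(\Gamma)\subset\mathbb R^{E(\Gamma)}$ is the set of families $(d_a)$ of non-negative real numbers such that for any three mutually distinct edges $a,b,c$ incident to the same vertex, $|d_a-d_b|\leqslant d_c\leqslant d_a+d_b$. $\Delta(\ell,\Gamma)\subset\mathbb R^{E_{\mathrm{int}}(\Gamma)}$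 is the set of $(d_a)_{a\in E_{\mathrm{int}}(\Gamma)}$ such that the family obtained by assigning $\ell_i$ to the half-edge $i$ and $d_a$ to the internal edge $a$ belongs to $\Delta(\Gamma)$. *)

(* Defs.v *)
From HB Require Import structures.
From mathcomp Require Import all_boot all_order all_algebra.
From mathcomp Require Import complex.
From mathcomp Require Import all_classical all_reals all_analysis.
From mathcomp Require Import ring lra.

Set Implicit Arguments.
Unset Strict Implicit.
Unset Printing Implicit Defensive.

Import Order.TTheory GRing.Theory Num.Theory.
Import numFieldNormedType.Exports.

Local Open Scope classical_set_scope.
Local Open Scope ring_scope.
Local Open Scope complex_scope.
Local Open Scope sesquilinear_scope.
Local Open Scope quotient_scope.

Lemma invmx_mul (F : comUnitRingType) m (g h : 'M[F]_m) :
  g \in unitmx -> h \in unitmx -> invmx (g *m h) = invmx h *m invmx g.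
Proof.
move=> gu hu; have ghu : g *m h \in unitmx by rewrite unitmx_mul gu hu.
apply: (can_inj (mulKmx ghu)); rewrite mulmxV // mulmxA -(mulmxA g).
by rewrite mulmxV // mulmx1 mulmxV.
Qed.

Lemma mxtrace_conj (F : comUnitRingType) m (g A B : 'M[F]_m) :
  g \in unitmx -> \tr (g *m A *m invmx g *m (g *m B *m invmx g)) = \tr (A *m B).
Proof.
move=> gu; rewrite !mulmxA mulmxKV // mxtrace_mulC !mulmxA.
by rewrite mulVmx // mul1mx.
Qed.

Section Su2.
Variable R : realType.
Implicit Types (A B g h : 'M[R[i]]_2) (u v w x y xi : 'rV[R]_3).

Definition is_su2 A : Prop := A ^t* = - A /\ \tr A = 0.

Definition is_SU2 g : Prop := g \is unitarymx /\ \det g = 1.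

(* su(2) is coordinatised by 'rV[R]_3 in the basis ('i times the Pauli
   matrices), which provides its topology; su2mx is a linear bijection onto
   su(2) by su2mx_su2, su2mxK and su2vecK. *)
Definition su2mx v : 'M[R[i]]_2 := \matrix_(i < 2, j < 2)
  if i == 0 then if j == 0 then 0 +i* v 0 2%:R else v 0 1 +i* v 0 0
  else if j == 0 then (- v 0 1) +i* v 0 0 else 0 +i* (- v 0 2%:R).

Definition su2vec A : 'rV[R]_3 := \row_(k < 3)
  if k == 0 then complex.Im (A 0 1) else
  if k == 1 then complex.Re (A 0 1) else complex.Im (A 0 0).

Definition su2_dot v w : R := complex.Re (- 2^-1 * \tr (su2mx v *m su2mx w)).

(* A form in su(2)^* is represented by the x for which it equals su2_dot x; the
   norm of su(2)^* is the one making this identification isometric. *)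
Definition su2_norm x : R := Num.sqrt (su2_dot x x).

Definition Ad g v : 'rV[R]_3 := su2vec (g *m su2mx v *m invmx g).

(* (coAd g x) (v) = x (Ad g^-1 v), see coAdP *)
Definition coAd g x : 'rV[R]_3 := \row_k su2_dot x (Ad (invmx g) (delta_mx 0 k)).

Definition su2_bracket v w : 'rV[R]_3 :=
  su2vec (su2mx v *m su2mx w - su2mx w *m su2mx v).

(* (coad xi x) (v) = - x ([xi, v]), see coadP *)
Definition coad xi x : 'rV[R]_3 :=
  \row_k - su2_dot x (su2_bracket xi (delta_mx 0 k)).

Lemma mx2P A B : A 0 0 = B 0 0 -> A 0 1 = B 0 1 -> A 1 0 = B 1 0 ->
  A 1 1 = B 1 1 -> A = B.
Proof.
move=> h00 h01 h10 h11; apply/matrixP => i j.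
have e0 (k : 'I_2) : k = 0 \/ k = 1.
  by case: k => [[|[|//]] ?]; [left|right]; apply/val_inj.
by case: (e0 i) => ->; case: (e0 j) => ->.
Qed.

Lemma row3P u v :
  u 0 0 = v 0 0 -> u 0 1 = v 0 1 -> u 0 2%:R = v 0 2%:R -> u = v.
Proof.
move=> h0 h1 h2; apply/rowP => -[[|[|[|//]]] hk].
- by rewrite (_ : Ordinal hk = 0) //; exact/val_inj.
- by rewrite (_ : Ordinal hk = 1) //; exact/val_inj.
- by rewrite (_ : Ordinal hk = 2%:R) //; exact/val_inj.
Qed.

Lemma sumI2 (V : nmodType) (F : 'I_2 -> V) : \sum_(i < 2) F i = F 0 + F 1.
Proof.
by rewrite !big_ord_recl big_ord0 addr0; congr (F _ + F _); apply/val_inj.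
Qed.

Lemma sumI3 (V : nmodType) (F : 'I_3 -> V) :
  \sum_(i < 3) F i = F 0 + F 1 + F 2%:R.
Proof.
rewrite !big_ord_recl big_ord0 addr0 addrA.
by congr (F _ + F _ + F _); apply/val_inj.
Qed.

Lemma su2mxK : cancel su2mx su2vec.
Proof. by move=> v; apply: row3P; rewrite !mxE. Qed.

Lemma su2mx_su2 v : is_su2 (su2mx v).
Proof.
split; last first.
  by rewrite /mxtrace sumI2 !mxE /=; apply/eqP;
    rewrite eq_complex /= !addr0 addrN !eqxx.
by apply: mx2P; rewrite !mxE; apply/eqP;
  rewrite eq_complex /= ?oppr0 ?opprK !eqxx.
Qed.

Lemma su2vecK A : is_su2 A -> su2mx (su2vec A) = A.
Proof.
move=> [hA]; rewrite /mxtrace sumI2.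
have := congr1 (fun M : 'M[R[i]]_2 => M 0 0) hA.
have := congr1 (fun M : 'M[R[i]]_2 => M 1 0) hA.
rewrite !mxE => h10 h00 h11; apply: mx2P; rewrite !mxE /=; move: h10 h00 h11.
all: case: (A 0 0) => a b; case: (A 0 1) => c d; case: (A 1 0) => e f.
all: case: (A 1 1) => p q.
all: move=> /eqP; rewrite eq_complex /= => /andP[/eqP he /eqP hf].
all: move=> /eqP; rewrite eq_complex /= => /andP[/eqP ha _].
all: move=> /eqP; rewrite eq_complex /= => /andP[/eqP hp /eqP hq].
all: congr (_ +i* _); first [by [] | by move: hp hq ha he hf; lra].
Qed.

Lemma su2_dotE v w :
  su2_dot v w = v 0 0 * w 0 0 + v 0 1 * w 0 1 + v 0 2%:R * w 0 2%:R.
Proof.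
rewrite /su2_dot (_ : 2^-1 = (2^-1 : R)%:C); last first.
  by rewrite fmorphV rmorph_nat.
rewrite /mxtrace sumI2 !mxE !sumI2 !mxE /=; by field.
Qed.

Lemma su2_dot_delta x k : su2_dot x (delta_mx 0 k) = x 0 k.
Proof.
rewrite su2_dotE !mxE /=; case: k => [[|[|[|//]]] hk].
- by rewrite (_ : Ordinal hk = 0) /=; [ring|exact/val_inj].
- by rewrite (_ : Ordinal hk = 1) /=; [ring|exact/val_inj].
- by rewrite (_ : Ordinal hk = 2%:R) /=; [ring|exact/val_inj].
Qed.

Lemma su2_dotC v w : su2_dot v w = su2_dot w v.
Proof. by rewrite !su2_dotE; ring. Qed.

Lemma su2_dotDl v w x : su2_dot (v + w) x = su2_dot v x + su2_dot w x.
Proof. by rewrite !su2_dotE !mxE; ring. Qed.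

Lemma su2_dotZl (a : R) v x : su2_dot (a *: v) x = a * su2_dot v x.
Proof. by rewrite !su2_dotE !mxE; ring. Qed.

Lemma su2_dotPr (a : R) x v w :
  su2_dot x (a *: v + w) = a * su2_dot x v + su2_dot x w.
Proof. by rewrite !su2_dotE !mxE; ring. Qed.

Lemma su2mxD v w : su2mx (v + w) = su2mx v + su2mx w.
Proof.
by apply: mx2P; rewrite !mxE; apply/eqP;
  rewrite eq_complex /= ?addr0 ?opprD !eqxx.
Qed.

Lemma su2mxZ (a : R) v : su2mx (a *: v) = a%:C *: su2mx v.
Proof.
by apply: mx2P; rewrite !mxE; apply/eqP; rewrite eq_complex /=;
  apply/andP; split; apply/eqP; ring.
Qed.

Lemma su2vec_linear (a : R) A B :
  su2vec (a%:C *: A + B) = a *: su2vec A + su2vec B.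
Proof.
apply: row3P; rewrite !mxE /=.
all: case: (A 0 0) => ? ?; case: (A 0 1) => ? ?.
all: case: (B 0 0) => ? ?; case: (B 0 1) => ? ? /=; ring.
Qed.

Lemma su2_bracketE v w : su2_bracket v w = \row_(k < 3)
  if k == 0 then 2 * (v 0 2%:R * w 0 1 - v 0 1 * w 0 2%:R) else
  if k == 1 then 2 * (v 0 0 * w 0 2%:R - v 0 2%:R * w 0 0) else
  2 * (v 0 1 * w 0 0 - v 0 0 * w 0 1).
Proof.
by apply: row3P; rewrite [RHS]mxE /su2_bracket mxE /= !mxE !sumI2 !mxE /=; ring.
Qed.

Lemma SU2_conj g A : is_SU2 g -> is_su2 A -> is_su2 (g *m A *m invmx g).
Proof.
move=> [gU _] [hA tA]; have gu := unitarymx_unit gU; split.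
  rewrite invmx_unitary // !trmx_mul !map_mxM -[(g ^t*)^t*]/(_) trmxCK hA.
  by rewrite mulNmx mulmxN mulmxA.
by rewrite mxtrace_mulC mulmxA mulVmx // mul1mx.
Qed.

Lemma su2mx_Ad g v : is_SU2 g -> su2mx (Ad g v) = g *m su2mx v *m invmx g.
Proof. by move=> gS; rewrite su2vecK //; exact/SU2_conj/su2mx_su2. Qed.

Lemma su2_dot_Ad g v w : is_SU2 g -> su2_dot (Ad g v) (Ad g w) = su2_dot v w.
Proof.
move=> gS.
transitivity (complex.Re (- 2^-1 *
    \tr (g *m su2mx v *m invmx g *m (g *m su2mx w *m invmx g)))).
  exact: (f_equal2 (fun A B => complex.Re (- 2^-1 * \tr (A *m B)))
    (su2mx_Ad v gS) (su2mx_Ad w gS)).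
exact: (f_equal (fun a => complex.Re (- 2^-1 * a))
  (mxtrace_conj (su2mx v) (su2mx w) (unitarymx_unit gS.1))).
Qed.

Lemma SU2_1 : is_SU2 1%:M.
Proof. by split; [apply/unitarymxP; rewrite trmx1 map_mx1 mulmx1|exact: det1]. Qed.

Lemma SU2_M g h : is_SU2 g -> is_SU2 h -> is_SU2 (g *m h).
Proof.
move=> [gU dg] [hU dh]; split; first exact: (mul_unitarymx gU hU).
by rewrite (det_mulmx g h) dg dh (mulr1 1).
Qed.

Lemma SU2_V g : is_SU2 g -> is_SU2 (invmx g).
Proof.
move=> [gU dg]; split; last by rewrite (det_inv g) dg invr1.
by rewrite (invmx_unitary gU) (trmxC_unitary g).
Qed.

Lemma Ad1 v : Ad 1%:M v = v.
Proof. by rewrite /Ad invmx1 mulmx1 mul1mx su2mxK. Qed.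

Lemma AdM g h v : is_SU2 g -> is_SU2 h -> Ad g (Ad h v) = Ad (g *m h) v.
Proof.
move=> gS hS; rewrite {1 3}/Ad (su2mx_Ad v hS).
by rewrite (invmx_mul (unitarymx_unit gS.1) (unitarymx_unit hS.1)) !mulmxA.
Qed.

Lemma AdVK g v : is_SU2 g -> Ad (invmx g) (Ad g v) = v.
Proof.
move=> gS; rewrite (AdM v (SU2_V gS) gS).
by rewrite (mulVmx (unitarymx_unit gS.1)) Ad1.
Qed.

Lemma AdKV g v : is_SU2 g -> Ad g (Ad (invmx g) v) = v.
Proof.
move=> gS; rewrite (AdM v gS (SU2_V gS)).
by rewrite (mulmxV (unitarymx_unit gS.1)) Ad1.
Qed.

Lemma coAd_Ad g x : is_SU2 g -> coAd g x = Ad g x.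
Proof.
move=> gS; apply/rowP => k; rewrite mxE -(su2_dot_Ad _ _ gS) (AdKV _ gS).
exact: su2_dot_delta.
Qed.

Lemma coAdP g x v : is_SU2 g -> su2_dot (coAd g x) v = su2_dot x (Ad (invmx g) v).
Proof. by move=> gS; rewrite (coAd_Ad x gS) -[in RHS](su2_dot_Ad _ _ gS) (AdKV v gS). Qed.

Lemma coAdD g x y : coAd g (x + y) = coAd g x + coAd g y.
Proof. by apply/rowP => k; rewrite !mxE su2_dotDl. Qed.

Lemma coAd0 g : coAd g 0 = 0.
Proof.
by apply/rowP => k; rewrite mxE su2_dotE !mxE; ring.
Qed.

Lemma su2_norm_coAd g x : is_SU2 g -> su2_norm (coAd g x) = su2_norm x.
Proof. by move=> gS; rewrite /su2_norm (coAd_Ad x gS) (su2_dot_Ad x x gS). Qed.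

Lemma coadE xi x : coad xi x = su2_bracket xi x.
Proof.
rewrite [RHS]su2_bracketE; apply: row3P; rewrite mxE su2_bracketE su2_dotE !mxE /=.
all: by ring.
Qed.

Lemma coadP xi x v : su2_dot (coad xi x) v = - su2_dot x (su2_bracket xi v).
Proof. by rewrite coadE !su2_bracketE !su2_dotE !mxE /=; ring. Qed.

Lemma coad_linear (a : R) xi u x :
  coad (a *: xi + u) x = a *: coad xi x + coad u x.
Proof.
by rewrite !coadE !su2_bracketE; apply: row3P; rewrite !mxE /=; ring.
Qed.
End Su2.

(* src and tgt record an arbitrary choice of direction of each internal edge *)
Record half_edge_graph (n : nat) := HalfEdgeGraph {
  vertex : finType;
  iedge : finType;
  src : iedge -> vertex;
  tgt : iedge -> vertex;
  hend : 'I_n -> vertex }.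

Section Graph.
Variables (n : nat) (G : half_edge_graph n).

Definition edge : Type := (iedge G + 'I_n)%type.

Definition incident (e : edge) (v : vertex G) : bool :=
  match e with
  | inl a => (src a == v) || (tgt a == v)
  | inr i => hend G i == v
  end.

Definition adjacent : rel (vertex G) := fun u v =>
  [exists a : iedge G, [&& src a == u & tgt a == v] || [&& src a == v & tgt a == u]].

Definition connected_graph : Prop := forall u v : vertex G, connect adjacent u v.

(* an internal edge with a direction of travel: src to tgt if d.2 is true *)
Definition dart : Type := (iedge G * bool)%type.
Definition dart_src (d : dart) : vertex G := if d.2 then src d.1 else tgt d.1.
Definition dart_tgt (d : dart) : vertex G := if d.2 then tgt d.1 else src d.1.

(* no nonempty closed walk traverses its edges at most once; this also rules out
   loops and multiple edges *)
Definition acyclic_graph : Prop := forall c : seq dart, c != [::] ->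
  uniq [seq d.1 | d <- c] ->
  ~~ cycle (fun d d' => dart_tgt d == dart_src d') c.

Definition valence (v : vertex G) : nat :=
  (#|[pred a | src a == v]| + #|[pred a | tgt a == v]| +
   #|[pred i | hend G i == v]|)%N.

Definition admissible : Prop :=
  [/\ connected_graph, acyclic_graph & forall v, valence v = 3%N].

(* connected to the initial vertex by a path avoiding the terminal vertex *)
Definition half_edges_behind (a : iedge G) : {set 'I_n} :=
  [set i | connect (fun u v => [&& adjacent u v, u != tgt a & v != tgt a])
             (src a) (hend G i)].

End Graph.

Section PolygonSpace.
Variables (R : realType) (n : nat) (l : 'I_n -> R).

(* the i-th row of x : 'M_(n, 3) is the point x_i of su(2)^* *)
Definition sphere (m : R) : set 'rV[R]_3 := [set x | su2_norm x = m].

Definition closed_polygons : set 'M[R]_(n, 3) :=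
  [set x | (forall i, sphere (l i) (row i x)) /\ \sum_i row i x = 0].

Definition coAd_rel (x y : closed_polygons) : bool :=
  `[< exists2 g, is_SU2 g & forall i, row i (\val y) = coAd g (row i (\val x)) >].

Lemma coAd_rel_refl : reflexive coAd_rel.
Proof.
move=> x; apply/asboolP; exists 1%:M; first exact: SU2_1.
by move=> i; rewrite coAd_Ad ?Ad1 //; exact: SU2_1.
Qed.

Lemma coAd_rel_sym : symmetric coAd_rel.
Proof.
suff h x y : coAd_rel x y -> coAd_rel y x by move=> x y; apply/idP/idP; exact: h.
move=> /asboolP[g gS xy]; apply/asboolP; exists (invmx g); first exact: SU2_V.
by move=> i; rewrite xy (coAd_Ad _ gS) (coAd_Ad _ (SU2_V gS)) (AdVK _ gS).
Qed.

Lemma coAd_rel_trans : transitive coAd_rel.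
Proof.
move=> y x z /asboolP[g gS xy] /asboolP[h hS yz]; apply/asboolP.
exists (h *m g) => [|i]; first exact: SU2_M.
rewrite yz xy (coAd_Ad _ gS) (coAd_Ad _ hS) (coAd_Ad _ (SU2_M hS gS)).
exact: AdM.
Qed.

Canonical coAd_equiv : equiv_rel closed_polygons :=
  EquivRel coAd_rel coAd_rel_refl coAd_rel_sym coAd_rel_trans.

Definition polygon_space : Type := quotient_topology {eq_quot coAd_rel}.
HB.instance Definition _ := Topological.on polygon_space.

Definition polygon_class (x : closed_polygons) : polygon_space :=
  \pi_(quotient_topology {eq_quot coAd_rel}) x.

(* on closed polygons an affine line containing all the points passes through 0 *)
Definition collinear (x : 'M[R]_(n, 3)) : Prop :=
  exists2 u : 'rV[R]_3, u != 0 & forall i, exists t : R, row i x = t *: u.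

Definition singular_polygons : set polygon_space :=
  [set polygon_class x | x in [set x : closed_polygons | collinear (\val x)]].

Section Lengths.
Variable G : half_edge_graph n.

Definition diagonal_length (a : iedge G) (x : 'M[R]_(n, 3)) : R :=
  su2_norm (\sum_(i in half_edges_behind a) row i x).

(* by lambdaE this does not depend on the representative *)
Definition lambda (p : polygon_space) : {ptws iedge G -> R} :=
  fun a => diagonal_length a (\val (repr p)).

Lemma lambdaE (x : closed_polygons) a :
  lambda (polygon_class x) a = diagonal_length a (\val x).
Proof.
have /asboolP[g gS xy] : coAd_rel (repr (polygon_class x)) x.
  by have /eqquotP := reprK (polygon_class x).
rewrite /lambda /diagonal_length -(su2_norm_coAd _ gS); congr su2_norm.
rewrite (big_morph _ (coAdD g) (coAd0 g)).
by apply: eq_bigr => i _; rewrite xy.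
Qed.

Definition nonvanishing_polygons : set polygon_space :=
  [set p | ~ singular_polygons p /\ forall a : iedge G, lambda p a != 0].

Definition Delta : set (edge G -> R) := [set d | (forall e, 0 <= d e) /\
  forall (v : vertex G) (a b c : edge G),
    incident a v -> incident b v -> incident c v ->
    a != b -> b != c -> a != c -> `|d a - d b| <= d c <= d a + d b].

Definition Delta_l : set {ptws iedge G -> R} := [set d |
  Delta (fun e => match e with inl a => d a | inr i => l i end)].

Definition regular_polygons : set polygon_space := lambda @^-1` (Delta_l°).

End Lengths.

(* derivative at z of the equations sum_i x_i = 0 and |x_i|^2 / 2 = l_i^2 / 2 *)
Definition dconstraint (z v : 'M[R]_(n, 3)) : ('rV[R]_3 * 'rV[R]_n)%type :=
  (\sum_i row i v, \row_i su2_dot (row i z) (row i v)).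

Lemma dconstraint_linear z : linear (dconstraint z).
Proof.
move=> a u v.
have hs : \sum_i row i (a *: u + v) = a *: (\sum_i row i u) + \sum_i row i v.
  by rewrite scaler_sumr -big_split; apply: eq_bigr => i _; rewrite linearP.
have hd : \row_i su2_dot (row i z) (row i (a *: u + v)) =
    a *: (\row_i su2_dot (row i z) (row i u)) + \row_i su2_dot (row i z) (row i v).
  by apply/rowP => i; rewrite !mxE linearP /= su2_dotPr.
exact: (f_equal2 pair hs hd).
Qed.

HB.instance Definition _ z := GRing.isLinear.Build R 'M[R]_(n, 3)
  ('rV[R]_3 * 'rV[R]_n)%type _ (dconstraint z) (dconstraint_linear z).

(* tangent space at z of closed_polygons, at non-collinear z where the
   constraints are independent *)
Definition tangent (z : 'M[R]_(n, 3)) : {vspace 'M[R]_(n, 3)} :=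
  lker (linfun (dconstraint z)).

Definition inf_coAd (z : 'M[R]_(n, 3)) (xi : 'rV[R]_3) : 'M[R]_(n, 3) :=
  \matrix_i coad xi (row i z).

Lemma inf_coAd_linear z : linear (inf_coAd z).
Proof.
have h xi i j : inf_coAd z xi i j = coad xi (row i z) 0 j by rewrite /inf_coAd mxE.
have lin p q (b : R) (A B : 'M[R]_(p, q)) i j :
  (b *: A + B) i j = b * A i j + B i j by rewrite !mxE.
move=> a u v; apply/matrixP => i j.
apply: (etrans (h _ i j)); apply: (etrans _ (esym (lin _ _ a _ _ i j))).
apply: (etrans (f_equal (fun M : 'rV[R]_3 => M 0 j) (coad_linear a u v _))).
apply: (etrans (lin _ _ a _ _ 0 j)).
exact: (f_equal2 (fun p q => a * p + q) (esym (h u i j)) (esym (h v i j))).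
Qed.

HB.instance Definition _ z := GRing.isLinear.Build R 'rV[R]_3 'M[R]_(n, 3) _
  (inf_coAd z) (inf_coAd_linear z).

Definition orbit_tangent (z : 'M[R]_(n, 3)) : {vspace 'M[R]_(n, 3)} :=
  limg (linfun (inf_coAd z)).

Lemma tangentP z v : reflect
  (\sum_i row i v = 0 /\ forall i, su2_dot (row i z) (row i v) = 0)
  (v \in tangent z).
Proof.
rewrite memv_ker lfunE /=; apply: (iffP eqP) => [[h0 h1]|[h0 h1]].
  by split=> // i; have /rowP/(_ i) := h1; rewrite !mxE.
by congr pair => //; apply/rowP => i; rewrite !mxE h1.
Qed.

Lemma orbit_tangentP z v :
  (v \in orbit_tangent z) <-> exists xi, v = inf_coAd z xi.
Proof.
split => [/memv_imgP[xi _ ->]|[xi ->]]; first by exists xi; rewrite lfunE.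
by rewrite -[inf_coAd z xi](lfunE (inf_coAd z)) memv_img ?memvf.
Qed.

(* phi is the differential at z of the lift of f to closed_polygons, restricted
   from an ambient form psi to the tangent space; it vanishes on the directions
   of the SU(2)-orbit, hence is a linear form on tangent z / orbit_tangent z,
   the tangent space of polygon_space at the class of a non-collinear z. *)
Definition is_differential (f : polygon_space -> R) (z : closed_polygons)
    (phi : 'Hom(subvs_of (tangent (\val z)), R^o)) : Prop :=
  (forall u, vsval u \in orbit_tangent (\val z) -> phi u = 0) /\
  exists2 psi : 'Hom('M[R]_(n, 3), R^o),
    forall u, phi u = psi (vsval u) &
    forall e : R, 0 < e -> \forall w \near z,
      `|f (polygon_class w) - f (polygon_class z) - psi (\val w - \val z)|
        <= e * `|\val w - \val z|.

End PolygonSpace.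

Arguments lambda {R n l} G p.
Arguments Delta_l {R n} l G.
Arguments nonvanishing_polygons {R n} l G.
Arguments regular_polygons {R n} l G.
Arguments is_differential {R n l} f z phi.

(* Main.v *)
Require Import Defs.
From HB Require Import structures.
From mathcomp Require Import all_boot all_order all_algebra.
From mathcomp Require Import all_classical all_reals all_analysis.
From mathcomp Require Import ring lra.
Import Order.TTheory GRing.Theory Num.Theory.
Import numFieldNormedType.Exports.
Local Open Scope classical_set_scope.
Local Open Scope ring_scope.

Set Implicit Arguments.
Unset Strict Implicit.
Unset Printing Implicit Defensive.

(** Cutting an internal edge splits the half-edges into two branches, and the
partial sums of a closed polygon over them are opposite, so that a diagonal is
the length of either one. At a vertex the three outgoing branches partition
the half-edges ([branch_partition]) and the three partial sums add up to 0.
Hence a closed polygon is a tree of Euclidean triangles glued along sides of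
equal length, and the theorem follows from the geometry of one triangle by
induction along the tree ([dart_ind], [xdart_ind]).

Image. The triangle inequality at each vertex puts the lengths in the
polyhedron. Conversely, a given side completes to a triangle of admissible
lengths ([triangle_exists]), and triangles are added one by one beyond the two
ends of an internal edge ([realize], [Delta_lambda]).

Fibers. Two triangles with a common side w and equal lengths differ by a
rotation fixing w ([rotation_of_triangle]), which rotations about the same axis
join to the identity. Bending everything beyond w along this path, and then
each of the two sub-branches by induction, joins any two closed polygons with
the same diagonals ([bend_pair], [bend], [length_fiber_connected]); at the
root, an internal edge is cut and w is the total sum 0.

Interior. For n >= 4 every vertex carries an internal edge, whose length can be
varied, so the interior of the polyhedron is cut out by the strict triangle
inequalities ([interior_triangle_strict], [triangle_strict_interior]). By
Heron's formula a polygon is then regular if and only if at each vertex two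
partial sums are linearly independent ([regular_cross], [cross_regular]). In
particular its diagonals are nonzero and it lies on no line.

Density. Independence at one vertex is an open condition, so it is enough to
reach it by a small move for one vertex at a time, and there only the partition
of the half-edges into three nonempty sets matters ([separable_polygon]).
Rotating two non-parallel x_i, x_j about x_i + x_j moves their partial sums
along an arc of a circle, which is contained in no line ([bend_edges],
[separable_third]). A polygon on a line has at least two edges in each
direction because l_j < (l_1 + ... + l_n) / 2; shortening the sum of two edges
of either direction by the same amount pushes it off the line
([perturb_line]).

Differentials. The differential of |Y| is the form <Y, .> / |Y|
([vnorm_expansion]). If a combination of these forms with coefficients c_a
vanishes on the tangent space, Lagrange multipliers ([lagrange]) turn the
relation into a vector-valued function P on the vertices which jumps by a
multiple c_a of the unit diagonal across each internal edge a, and which is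
parallel to x_i at the end of the half-edge i. Starting from the ends of the
tree, P is parallel to two independent vectors at each vertex, so it vanishes
and all c_a are 0 ([tree_potential]). *)

(** * Walks without backtracking in the tree *)

Section Tree.
Local Open Scope set_scope.
Variables (n : nat) (G : half_edge_graph n).
Hypothesis Gadm : admissible G.
Implicit Types (d e f : dart G) (a : iedge G) (v w : vertex G) (i : 'I_n).

Definition rev_dart d : dart G := (d.1, ~~ d.2).

Definition succ_dart : rel (dart G) := fun d e =>
  (dart_tgt d == dart_src e) && (e != rev_dart d).

Lemma rev_dartK : involutive rev_dart.
Proof. by move=> [a b]; rewrite /rev_dart /= negbK. Qed.

Lemma dart_src_rev d : dart_src (rev_dart d) = dart_tgt d.
Proof. by case: d => [a []]. Qed.

Lemma dart_tgt_rev d : dart_tgt (rev_dart d) = dart_src d.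
Proof. by case: d => [a []]. Qed.

Lemma succ_dart_rev d e : succ_dart (rev_dart e) (rev_dart d) = succ_dart d e.
Proof.
rewrite /succ_dart dart_tgt_rev dart_src_rev rev_dartK eq_sym.
by rewrite (can2_eq rev_dartK rev_dartK) [d == _]eq_sym (can2_eq rev_dartK rev_dartK).
Qed.

Lemma same_edge d e : d.1 = e.1 -> e = d \/ e = rev_dart d.
Proof.
by case: d e => [a b] [a' b'] /= <-; case: b b' => [] []; by [left|right].
Qed.

Lemma uniq_walk_open d (p : seq (dart G)) : path succ_dart d p ->
  uniq [seq x.1 | x <- d :: p] -> dart_tgt (last d p) != dart_src d.
Proof.
move=> dp up; have [_ + _] := Gadm => /(_ (d :: p) isT up).
apply: contraNN => close; rewrite /= rcons_path close andbT.
by apply: sub_path dp => x y /andP[].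
Qed.

(** A walk that never turns back cannot use an edge twice: the part between two
uses would be a closed walk. The induction on the length makes that part a walk
with distinct edges, which acyclicity excludes. *)
Lemma walk_edges_uniq d (p : seq (dart G)) :
  path succ_dart d p -> uniq [seq x.1 | x <- d :: p].
Proof.
have [k] := ubnP (size p); elim: k => // k IH in d p *.
rewrite ltnS => szp dp.
have tail_uniq : uniq [seq x.1 | x <- p].
  by case: p => // e p in szp dp *; apply: IH => //; case/andP: dp.
rewrite map_cons cons_uniq tail_uniq andbT; apply/negP => /mapP[y yp dy].
case/splitPr: yp => p1 p2 in szp dp *.
move: dp; rewrite cat_path /= => /and3P[dp1 /andP[/eqP ty ny] _].
have szp1 : (size p1 < k)%N.
  by apply: leq_trans szp; rewrite size_cat /= addnS ltnS leq_addr.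
have [yd|yd] := same_edge dy; first subst y.
  by have := uniq_walk_open dp1 (IH _ _ szp1 dp1); rewrite ty eqxx.
subst y; clear szp; case: p1 => [|x p1] in szp1 dp1 ty ny *; first by rewrite eqxx in ny.
move: dp1 => /= /andP[/andP[/eqP dx _] xp1].
have := uniq_walk_open xp1 (IH _ _ (ltnW szp1) xp1).
by move: ty => /= ->; rewrite dart_src_rev dx eqxx.
Qed.

Lemma reach_open d e : connect succ_dart d e -> dart_tgt e != dart_src d.
Proof.
by move=> /connectP[p dp ->]; apply: uniq_walk_open => //; exact: walk_edges_uniq.
Qed.

Lemma dart_loopless d : dart_tgt d != dart_src d.
Proof. exact/reach_open/connect0. Qed.

Lemma reach_rev d e :
  connect succ_dart d e -> connect succ_dart (rev_dart e) (rev_dart d).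
Proof.
move=> /connectP[p dp ->]; elim: p d dp => [|x p IH] d /=; first by rewrite connect0.
move=> /andP[dx xp]; apply: connect_trans (IH _ xp) (connect1 _).
by rewrite succ_dart_rev.
Qed.

(** Induction from the ends of the tree towards a dart: walks without
backtracking have bounded length. *)
Lemma dart_ind (P : dart G -> Prop) :
  (forall d, (forall e, succ_dart d e -> P e) -> P d) -> forall d, P d.
Proof.
move=> step d.
suff h k : (forall p, path succ_dart d p -> (size p < k)%N) -> P d.
  apply: (h #|iedge G|) => p /walk_edges_uniq/card_uniqP.
  by rewrite /= size_map => <-; exact: max_card.
elim: k d => [|k IH] d bd; first by have := bd [::] isT.
apply: step => e de; apply: IH => p ep.
by have := bd (e :: p); rewrite /= de; exact.
Qed.

(** If f turns back on the last step e of a walk, then its target is already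
reached one step earlier. *)
Lemma reach_step d e f : connect succ_dart d e -> dart_src f = dart_tgt e ->
  f != rev_dart d -> exists2 e', connect succ_dart d e' & dart_tgt e' = dart_tgt f.
Proof.
move=> de fe fd; have [fre|fre] := eqVneq f (rev_dart e); last first.
  by exists f => //; apply: connect_trans de (connect1 _); rewrite /succ_dart fe eqxx.
move/connectP: de => [p + ep]; case/lastP: p => [|p x] in ep *.
  by move: fd; rewrite fre ep eqxx.
rewrite rcons_path last_rcons in ep *; subst x => /andP[dp /andP[/eqP h _]].
exists (last d p); last by rewrite fre dart_tgt_rev.
by apply/connectP; exists p.
Qed.

Lemma adjacentP v w : reflect (exists2 f, dart_src f = v & dart_tgt f = w)
  (Defs.adjacent v w).
Proof.
apply: (iffP existsP) => [[a /orP[]/andP[/eqP <- /eqP <-]]|[[a b] <- <-]].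
- by exists (a, true).
- by exists (a, false).
- by exists a; case: b; rewrite !eqxx ?orbT.
Qed.

Lemma reach_vertex v w :
  v = w \/ exists d e, [/\ dart_src d = v, connect succ_dart d e & dart_tgt e = w].
Proof.
have [conn _ _] := Gadm; have /connectP[p + ->] := conn v w.
elim/last_ind: p => [|p x IH]; first by left.
rewrite rcons_path last_rcons => /andP[/IH {}IH /adjacentP[f fs <-]].
case: IH => [vp|[d [e [dv de ep]]]].
  by right; exists f, f; rewrite connect0 fs -vp.
have [fd|fd] := eqVneq f (rev_dart d).
  by left; rewrite fd dart_tgt_rev.
have [|e' de' e'f] := reach_step de _ fd; first by rewrite fs.
by right; exists d, e'.
Qed.

(** Half-edges are treated as darts without a target, so that the outgoing edges
of a vertex form one type with three elements at each vertex. *)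
Definition xdart : Type := (dart G + 'I_n)%type.
Implicit Types (x y : xdart).

Definition xdart_src x : vertex G :=
  match x with inl d => dart_src d | inr i => hend G i end.

Definition xdart_edge x : edge G :=
  match x with inl d => inl d.1 | inr i => inr i end.

Definition succ_xdart : rel xdart := fun x y =>
  if x is inl d then (dart_tgt d == xdart_src y) && (y != inl (rev_dart d)) else false.

Definition branch x : {set 'I_n} := [set i | connect succ_xdart x (inr i)].

Lemma reach_xdart_cases x y : connect succ_xdart x y ->
  match x, y return Prop with
  | inl d, inl e => connect succ_dart d e
  | inl d, inr i => exists2 e, connect succ_dart d e & dart_tgt e = hend G i
  | inr i, _ => y = inr i
  end.
Proof.
move=> /connectP[p xp ->]; elim: p x xp => [|z p IH] [d|i] //; first by move=> _; exact: connect0.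
move=> /andP[/andP[/eqP dz nz] /IH]; rewrite last_cons; case: z => [e|i] in dz nz *; last first.
  by move=> ->; exists d.
have de : connect succ_dart d e by apply: connect1; rewrite /succ_dart dz eqxx.
case: (last _ _) => [f|j]; first exact: connect_trans.
by move=> [f ef <-]; exists f => //; exact: connect_trans de ef.
Qed.

Lemma reach_xdart_inl d e : connect succ_dart d e ->
  connect succ_xdart (inl d) (inl e).
Proof.
move=> /connectP[p dp ->]; elim: p d dp => [|z p IH] d //= /andP[dz /IH].
by apply: connect_trans; apply: connect1.
Qed.

Lemma branch_dartP d i : reflect
  (exists2 e, connect succ_dart d e & dart_tgt e = hend G i) (i \in branch (inl d)).
Proof.
rewrite inE; apply: (iffP idP) => [/reach_xdart_cases//|[e de ei]].
apply: connect_trans (reach_xdart_inl de) (connect1 _).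
by rewrite /succ_xdart /= ei eqxx.
Qed.

Lemma branch_half i : branch (inr i) = [set i].
Proof.
apply/setP => j; rewrite !inE; apply/idP/eqP => [/reach_xdart_cases[//]|->].
exact: connect0.
Qed.

Lemma sub_branch x y : connect succ_xdart x y -> branch y \subset branch x.
Proof. by move=> xy; apply/fintype.subsetP => i; rewrite !inE; exact: connect_trans. Qed.

Lemma reach_xdartE d y : connect succ_xdart (inl d) y ->
  y = inl d \/ exists2 x, succ_xdart (inl d) x & connect succ_xdart x y.
Proof.
move=> /connectP[[|x p]] /= => [_ ->|/andP[dx xp] ->]; first by left.
by right; exists x => //; apply/connectP; exists p.
Qed.

Lemma xdart_ind (P : xdart -> Prop) : (forall i, P (inr i)) ->
  (forall d, (forall y, succ_xdart (inl d) y -> P y) -> P (inl d)) ->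
  forall x, P x.
Proof.
move=> Pi Pd [d|i] //; elim/dart_ind: d => d IH; apply: Pd => -[e|i] // de.
exact: IH.
Qed.

Lemma card_xdart_src v : #|[pred x : xdart | xdart_src x == v]| = 3%N.
Proof.
have [_ _ /(_ v) <-] := Gadm; rewrite /valence.
rewrite -!sum1_card big_sumType/=; congr (_ + _)%N.
rewrite (eq_bigl (fun d : dart G => true && (dart_src (d.1, d.2) == v))); last by case.
rewrite -(pair_big_dep xpredT (fun a b => dart_src (a, b) == v) (fun _ _ => 1%N)) /=.
rewrite [in RHS]big_mkcond [X in (_ + X)%N]big_mkcond -big_split /=.
by apply: eq_bigr => a _; rewrite big_mkcond big_bool.
Qed.

Lemma xdart_srcP v : exists x y z, [/\ xdart_src x = v, xdart_src y = v,
  xdart_src z = v & [/\ x != y, y != z & x != z]].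
Proof.
have /eqP := card_xdart_src v; rewrite cardE.
have := enum_uniq [pred x : xdart | xdart_src x == v].
have := mem_enum [pred x : xdart | xdart_src x == v].
case: (enum _) => [|x [|y [|z []]]] // mem /= + _.
rewrite !inE negb_or => /and3P[/andP[xy xz] yz _].
have src t : t \in [:: x; y; z] -> xdart_src t = v.
  by rewrite mem => /eqP.
by exists x, y, z; rewrite !src ?inE ?eqxx ?orbT.
Qed.

Lemma xdart_src_three x y z t : xdart_src x = xdart_src t ->
  xdart_src y = xdart_src t -> xdart_src z = xdart_src t ->
  x != y -> y != z -> x != z -> [\/ t = x, t = y | t = z].
Proof.
move=> xv yv zv xy yz xz.
have sub : {subset [:: x; y; z] <= enum [pred u : xdart | xdart_src u == xdart_src t]}.
  by move=> u; rewrite !inE mem_enum => /or3P[]/eqP->; rewrite inE /= ?xv ?yv ?zv.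
have u3 : uniq [:: x; y; z] by rewrite /= !inE negb_or xy yz xz.
have [|_ /(_ t)] := uniq_min_size u3 sub.
  by rewrite -cardE card_xdart_src.
rewrite !inE mem_enum inE eqxx => /or3P[]/eqP->; by [constructor 1|constructor 2|constructor 3].
Qed.

Lemma xdart_third x y : xdart_src x = xdart_src y -> x != y ->
  exists z, [/\ xdart_src z = xdart_src y, y != z & x != z].
Proof.
move=> xy nxy; have [u [v [w [uv vv wv [uv' vw uw]]]]] := xdart_srcP (xdart_src y).
have [ux|ux] := eqVneq x u; have [vx|vx] := eqVneq x v;
  have [uy|uy] := eqVneq y u; have [vy|vy] := eqVneq y v; subst;
  by [exists u|exists v|exists w|rewrite eqxx in nxy|rewrite eqxx in uv'].
Qed.

(** A half-edge in two branches at the same vertex would give a walk that goes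
from it to the vertex and back to it without turning back. *)
Lemma branch_disjoint x y i : xdart_src x = xdart_src y -> x != y ->
  i \in branch x -> i \in branch y -> False.
Proof.
wlog: x y / (if x is inl _ then true else false).
  move=> wl xy nxy ix iy; case: x => [d|j] in xy nxy ix *; first exact: (wl (inl d) y).
  case: y => [d|k] in xy nxy iy *; first by apply: (wl (inl d) (inr j)) => //; rewrite eq_sym.
  move: ix iy; rewrite !branch_half !inE => /eqP ij /eqP ik.
  by move: nxy; rewrite -ij -ik eqxx.
case: x => // d _ /= dy ndy /branch_dartP[f df fi].
case: y dy ndy => [e|j] /= de nde.
  move=> /branch_dartP[g eg gi].
  have rde : succ_dart (rev_dart d) e.
    by rewrite /succ_dart dart_tgt_rev de eqxx rev_dartK; apply: contraNneq nde => ->.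
  have := reach_open (connect_trans (connect_trans (reach_rev df) (connect1 rde)) eg).
  by rewrite dart_src_rev fi gi eqxx.
rewrite branch_half inE => /eqP ij; have := reach_open df.
by rewrite fi de ij eqxx.
Qed.

Lemma branch_cover v i : exists2 x, xdart_src x = v & i \in branch x.
Proof.
have [vi|[d [e [dv de ei]]]] := reach_vertex v (hend G i).
  by exists (inr i) => //; rewrite branch_half inE.
by exists (inl d) => //; apply/branch_dartP; exists e.
Qed.

Lemma branch_partition x y z i : xdart_src x = xdart_src z ->
  xdart_src y = xdart_src z -> x != y -> y != z -> x != z ->
  ((i \in branch x) + (i \in branch y) + (i \in branch z) = 1)%N.
Proof.
move=> xz yz nxy nyz nxz.
have dis s t : xdart_src s = xdart_src t -> s != t ->
    i \in branch s -> (i \in branch t) = false.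
  by move=> st nst is_; apply/negP; exact: branch_disjoint st nst is_.
have [t tv it] := branch_cover (xdart_src z) i.
have [|||e|e|e] := xdart_src_three (t := t) _ _ _ nxy nyz nxz; rewrite ?tv //; subst t.
- by rewrite it (dis x y) ?(dis x z) ?xz ?yz.
- by rewrite it (dis y x) ?(dis y z) ?xz ?yz // eq_sym.
- by rewrite it (dis z x) ?(dis z y) ?xz ?yz // eq_sym.
Qed.

Lemma succ_xdartP d : exists x y, [/\ x != y, succ_xdart (inl d) x,
  succ_xdart (inl d) y & forall z, succ_xdart (inl d) z -> z = x \/ z = y].
Proof.
have [x [y [z [xv yv zv [xy yz xz]]]]] := xdart_srcP (dart_tgt d).
have rv : xdart_src (inl (rev_dart d)) = dart_tgt d := dart_src_rev d.
suff h x1 y1 z1 : xdart_src x1 = dart_tgt d -> xdart_src y1 = dart_tgt d ->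
    xdart_src z1 = dart_tgt d -> x1 != y1 -> y1 != z1 -> x1 != z1 ->
    inl (rev_dart d) = z1 -> exists x y, [/\ x != y, succ_xdart (inl d) x,
    succ_xdart (inl d) y & forall z, succ_xdart (inl d) z -> z = x \/ z = y].
  have [|||e|e|e] := xdart_src_three (t := inl (rev_dart d)) _ _ _ xy yz xz; rewrite ?rv //.
  - by apply: (h y z x) => //; rewrite eq_sym.
  - by apply: (h x z y) => //; rewrite eq_sym.
  - exact: (h x y z).
move=> {}xv {}yv {}zv {}xy {}yz {}xz e; exists x1, y1.
rewrite /succ_xdart xv yv e eqxx xz yz; split=> // t /andP[/eqP tv tz].
have [|||->|->|tz'] := xdart_src_three (t := t) _ _ _ xy yz xz; rewrite -?tv //; auto.
by rewrite tz' eqxx in tz.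
Qed.

Lemma succ_branchU d x y : x != y -> succ_xdart (inl d) x -> succ_xdart (inl d) y ->
  branch (inl d) = branch x :|: branch y.
Proof.
move=> xy dx dy; apply/setP => i; rewrite finset.in_setU; apply/idP/orP; last first.
  by move=> []; exact/fintype.subsetP/sub_branch/connect1.
rewrite inE => /reach_xdartE[//|[t dt ti]].
have [x' [y' [xy' _ _ h]]] := succ_xdartP d.
have : t = x \/ t = y.
  case: (h _ dx) (h _ dy) (h _ dt) xy => -> [] -> [] ->; rewrite ?eqxx //; auto.
by case=> <-; [left|right]; rewrite inE.
Qed.

Lemma succ_xdart_src d x : succ_xdart (inl d) x -> xdart_src x = dart_tgt d.
Proof. by move=> /andP[/eqP]. Qed.

Lemma branch_nonempty x : exists i, i \in branch x.
Proof.
elim/xdart_ind: x => [i|d IH]; first by exists i; rewrite branch_half inE.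
have [x [_ [_ dx _ _]]] := succ_xdartP d.
by have [i ix] := IH _ dx; exists i; apply: (fintype.subsetP _ _ ix); exact/sub_branch/connect1.
Qed.

Lemma branch_rev d : branch (inl (rev_dart d)) = ~: branch (inl d).
Proof.
have [x [y [xy dx dy h]]] := succ_xdartP (rev_dart d).
rewrite (succ_branchU xy dx dy); apply/setP => i; rewrite !inE.
have sx := succ_xdart_src dx; have sy := succ_xdart_src dy.
have nx : x != inl d by case/andP: dx; rewrite rev_dartK.
have ny : y != inl d by case/andP: dy; rewrite rev_dartK.
have := @branch_partition x y (inl d) i.
rewrite sx sy /= dart_tgt_rev => /(_ erefl erefl xy ny nx).
by rewrite !inE; do 3 case: connect.
Qed.

(** The walk from the source of d to the source of a goes on along a, unless it
has just come along a. *)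
Lemma reach_edge d a : exists e, e.1 = a /\
  (connect succ_dart d e \/ connect succ_dart (rev_dart d) e).
Proof.
have in_or e : dart_src e = dart_src d -> e = d \/ succ_dart (rev_dart d) e.
  move=> ed; have [->|ned] := eqVneq e d; first by left.
  by right; rewrite /succ_dart dart_tgt_rev ed eqxx rev_dartK.
have out e f : dart_src e = dart_src d -> connect succ_dart e f ->
    connect succ_dart d f \/ connect succ_dart (rev_dart d) f.
  move=> /in_or[->|re] ef; [by left|right].
  exact: connect_trans (connect1 re) ef.
have [va|[e [f [ed ef fa]]]] := reach_vertex (dart_src d) (dart_src (a, true)).
  by exists (a, true); split=> //; exact: (out (a, true)).
have [|nr] := eqVneq (a, true) (rev_dart f).
  case: f => f b in ef fa * => -[af _]; exists (f, b); split; first by rewrite af.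
  exact: out ef.
exists (a, true); split=> //; apply: out ed _; apply: connect_trans ef (connect1 _).
by rewrite /succ_dart fa eqxx.
Qed.

(** The vertices on the side of the source of a; on the ends of the half-edges
this is [half_edges_behind]. *)
Definition behind a v := connect
  (fun u v => [&& Defs.adjacent u v, u != tgt a & v != tgt a]) (src a) v.

Lemma behindP a v : reflect
  (exists2 e, connect succ_dart (a, false) e & dart_tgt e = v) (behind a v).
Proof.
apply: (iffP idP) => [/connectP[p + ->]|[e /connectP[p + ->] <-]].
  elim/last_ind: p => [_|p x IH]; first by exists (a, false); rewrite ?connect0.
  rewrite rcons_path last_rcons => /andP[/IH[e ae ep]].
  move=> /and3P[/adjacentP[f fs <-] _ fa]; apply: (@reach_step (a, false) e f ae).
    by rewrite fs ep.
  by apply: contra_neq fa => ->.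
elim/last_ind: p => [_|p x IH]; first exact: connect0.
move=> pp; move: (pp); rewrite rcons_path last_rcons => /andP[pp' /andP[/eqP px nx]].
apply: connect_trans (IH pp') (connect1 _); apply/and3P; split.
- by apply/adjacentP; exists x.
- by apply: (@reach_open (a, false)); apply/connectP; exists p.
- by apply: (@reach_open (a, false)); apply/connectP; exists (rcons p x); rewrite ?last_rcons.
Qed.

Lemma half_edges_behindE a : half_edges_behind a = branch (inl (a, false)).
Proof.
by apply/setP => i; rewrite inE; exact/(sameP (behindP _ _))/branch_dartP.
Qed.

Lemma branch_behind a b : branch (inl (a, b)) =
  if b then ~: half_edges_behind a else half_edges_behind a.
Proof.
case: b; rewrite half_edges_behindE //; exact: (branch_rev (a, false)).
Qed.

Lemma behind_src a : behind a (src a).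
Proof. exact: connect0. Qed.

Lemma behind_tgt a : behind a (tgt a) = false.
Proof.
by apply/behindP => -[e ae et]; have := reach_open ae; rewrite et eqxx.
Qed.

Lemma behind_other a a' : a != a' -> behind a (src a') = behind a (tgt a').
Proof.
move=> aa'; suff h f : f.1 = a' -> behind a (dart_src f) -> behind a (dart_tgt f).
  by apply/idP/idP; [exact: (h (a', true))|exact: (h (a', false))].
move=> fa /behindP[e ae ef]; apply/behindP; apply: (reach_step ae) => //.
by apply: contraNneq aa' => fe; rewrite -fa fe.
Qed.

Lemma xdart_edge_inj x y : xdart_src x = xdart_src y -> xdart_edge x = xdart_edge y -> x = y.
Proof.
case: x y => [d|i] [e|j] //= src; last by case=> ->.
move=> [de]; have [->//|ed] := same_edge de.
by move: (dart_loopless d); rewrite src ed dart_src_rev eqxx.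
Qed.

Lemma incidentP (s : edge G) v : reflect
  (exists2 x, xdart_src x = v & xdart_edge x = s) (incident s v).
Proof.
case: s => [a|i] /=; last first.
  by apply: (iffP eqP) => [<-|[[//|j] <- /= [->]]] //; exists (inr i).
apply: (iffP orP) => [[]/eqP <-|[[[a' []]|//] <- /= [->]]]; last 2 first.
- by left.
- by right.
- by exists (inl (a, true)).
- by exists (inl (a, false)).
Qed.

(** If the three edges at a vertex are half-edges, then their branches are
singletons which partition the n half-edges, so that n = 3. *)
Lemma internal_at x y z : (4 <= n)%N -> xdart_src x = xdart_src z ->
  xdart_src y = xdart_src z -> x != y -> y != z -> x != z ->
  exists a, [\/ xdart_edge x = inl a, xdart_edge y = inl a | xdart_edge z = inl a].
Proof.
move=> n4 xz yz nxy nyz nxz.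
case: x xz nxy nxz => [d|i] xz nxy nxz; first by exists d.1; constructor 1.
case: y yz nxy nyz => [d|j] yz nxy nyz; first by exists d.1; constructor 2.
case: z xz yz nxz nyz => [d|k] xz yz nxz nyz; first by exists d.1; constructor 3.
have : (\sum_(s < n) ((s \in [set i]) + (s \in [set j]) + (s \in [set k])) = n)%N.
  transitivity (\sum_(s < n) 1)%N; last by rewrite sum1_card card_ord.
  by apply: eq_bigr => s _; rewrite -!branch_half; exact: branch_partition.
have one (s : 'I_n) : (\sum_(t < n) (t \in [set s]) = 1)%N.
  rewrite (bigD1 s) //= inE eqxx big1 // => t ts.
  by rewrite inE (negbTE ts).
by rewrite !big_split /= !one => n3; rewrite -n3 in n4.
Qed.

Lemma dart_exists : (4 <= n)%N -> exists a : iedge G, True.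
Proof.
move=> n4; pose i0 : 'I_n := Ordinal (leq_trans (isT : 0 < 4)%N n4).
have [x [y [z [xv yv zv [xy yz xz]]]]] := xdart_srcP (hend G i0).
by have [||a _] := internal_at n4 _ _ xy yz xz; rewrite ?xv ?yv ?zv //; exists a.
Qed.

End Tree.

(** * Euclidean geometry of su(2) *)

(** The scalar product and the norm are sealed because all computations go through
their coordinates, never through the traces of complex matrices behind them. *)
HB.lock Definition dot (R : realType) (u v : 'rV[R]_3) : R := su2_dot u v.

HB.lock Definition vnorm (R : realType) (v : 'rV[R]_3) : R := su2_norm v.

HB.lock Definition cross (R : realType) (u v : 'rV[R]_3) : 'rV[R]_3 := \row_(i < 3)
  if i == 0 then u 0 1 * v 0 2%:R - u 0 2%:R * v 0 1 else
  if i == 1 then u 0 2%:R * v 0 0 - u 0 0 * v 0 2%:R else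
  u 0 0 * v 0 1 - u 0 1 * v 0 0.

Section Space.
Variable R : realType.
Implicit Types (u v w k x y : 'rV[R]_3) (a b c s t : R).

Lemma dotE u v : dot u v = u 0 0 * v 0 0 + u 0 1 * v 0 1 + u 0 2%:R * v 0 2%:R.
Proof. by rewrite dot.unlock su2_dotE. Qed.

Lemma crossE u v : [/\ cross u v 0 0 = u 0 1 * v 0 2%:R - u 0 2%:R * v 0 1,
  cross u v 0 1 = u 0 2%:R * v 0 0 - u 0 0 * v 0 2%:R
  & cross u v 0 2%:R = u 0 0 * v 0 1 - u 0 1 * v 0 0].
Proof. by rewrite cross.unlock !mxE. Qed.

Lemma cross0E u v : cross u v 0 0 = u 0 1 * v 0 2%:R - u 0 2%:R * v 0 1.
Proof. by case: (crossE u v). Qed.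

Lemma cross1E u v : cross u v 0 1 = u 0 2%:R * v 0 0 - u 0 0 * v 0 2%:R.
Proof. by case: (crossE u v). Qed.

Lemma cross2E u v : cross u v 0 2%:R = u 0 0 * v 0 1 - u 0 1 * v 0 0.
Proof. by case: (crossE u v). Qed.

Definition vecE := (mxE, cross0E, cross1E, cross2E).

Lemma crossDl u v w : cross (u + v) w = cross u w + cross v w.
Proof. by apply: row3P; rewrite !vecE; ring. Qed.

Lemma crossZl a u v : cross (a *: u) v = a *: cross u v.
Proof. by apply: row3P; rewrite !vecE; ring. Qed.

Lemma crossC u v : cross u v = - cross v u.
Proof. by apply: row3P; rewrite !vecE; ring. Qed.

Lemma crossvv u : cross u u = 0.
Proof. by apply: row3P; rewrite !vecE; ring. Qed.

Lemma crossDr u v w : cross u (v + w) = cross u v + cross u w.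
Proof. by apply: row3P; rewrite !vecE; ring. Qed.

Lemma crossZr a u v : cross u (a *: v) = a *: cross u v.
Proof. by apply: row3P; rewrite !vecE; ring. Qed.

Lemma crossNl u v : cross (- u) v = - cross u v.
Proof. by apply: row3P; rewrite !vecE; ring. Qed.

Lemma crossNr u v : cross u (- v) = - cross u v.
Proof. by apply: row3P; rewrite !vecE; ring. Qed.

Lemma cross0v v : cross 0 v = 0.
Proof. by apply: row3P; rewrite !vecE; ring. Qed.

Lemma crossv0 v : cross v 0 = 0.
Proof. by apply: row3P; rewrite !vecE; ring. Qed.

Lemma dotC u v : dot u v = dot v u.
Proof. by rewrite !dotE; ring. Qed.

Lemma dotDl u v w : dot (u + v) w = dot u w + dot v w.
Proof. by rewrite !dotE !vecE; ring. Qed.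

Lemma dotZl a u v : dot (a *: u) v = a * dot u v.
Proof. by rewrite !dotE !vecE; ring. Qed.

Lemma dot_delta v i : dot v (delta_mx 0 i) = v 0 i.
Proof. by rewrite dot.unlock su2_dot_delta. Qed.

Lemma dotDr u v w : dot u (v + w) = dot u v + dot u w.
Proof. by rewrite !dotE !vecE; ring. Qed.

Lemma dotZr a u v : dot u (a *: v) = a * dot u v.
Proof. by rewrite !dotE !vecE; ring. Qed.

Lemma dotNr u v : dot u (- v) = - dot u v.
Proof. by rewrite !dotE !vecE; ring. Qed.

Lemma dotNl u v : dot (- u) v = - dot u v.
Proof. by rewrite !dotE !vecE; ring. Qed.

Definition dot_lin := (dotDl, dotDr, dotNl, dotNr, dotZl, dotZr).

Lemma dot0l v : dot 0 v = 0.
Proof. by rewrite !dotE !vecE; ring. Qed.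

Lemma dot_ge0 v : 0 <= dot v v.
Proof. by rewrite dotE -!expr2 !addr_ge0 ?sqr_ge0. Qed.

Lemma dot_eq0 v : (dot v v == 0) = (v == 0).
Proof.
apply/eqP/eqP => [|->]; last by rewrite dot0l.
rewrite dotE => h; apply: row3P; rewrite mxE; apply/eqP;
  rewrite -sqrf_eq0; apply/eqP; nra.
Qed.

Lemma dot_gt0 v : (0 < dot v v) = (v != 0).
Proof. by rewrite lt0r dot_eq0 dot_ge0 andbT. Qed.

Lemma vnormE v : vnorm v = Num.sqrt (dot v v).
Proof. by rewrite vnorm.unlock dot.unlock. Qed.

Lemma vnorm_ge0 v : 0 <= vnorm v.
Proof. by rewrite vnormE sqrtr_ge0. Qed.

Lemma vnormK v : vnorm v ^+ 2 = dot v v.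
Proof. by rewrite vnormE sqr_sqrtr ?dot_ge0. Qed.

Lemma vnorm_eq0 v : (vnorm v == 0) = (v == 0).
Proof. by rewrite -sqrf_eq0 vnormK dot_eq0. Qed.

Lemma vnorm_gt0 v : (0 < vnorm v) = (v != 0).
Proof. by rewrite lt0r vnorm_eq0 vnorm_ge0 andbT. Qed.

Lemma vnorm_dot u v : vnorm u = vnorm v <-> dot u u = dot v v.
Proof. by split=> [h|h]; [rewrite -!vnormK h|rewrite !vnormE h]. Qed.

Lemma vnorm_eq v a : 0 <= a -> dot v v = a ^+ 2 -> vnorm v = a.
Proof. by move=> a0 h; rewrite !vnormE h sqrtr_sqr ger0_norm. Qed.

Lemma vnormN v : vnorm (- v) = vnorm v.
Proof. by rewrite !vnormE dotNl dotNr opprK. Qed.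

Lemma vnormZ a v : vnorm (a *: v) = `|a| * vnorm v.
Proof.
apply: vnorm_eq; first by rewrite mulr_ge0 ?vnorm_ge0.
by rewrite dotZl dotZr exprMn vnormK real_normK ?num_real // expr2 mulrA.
Qed.

Lemma dot_suml (I : Type) (r : seq I) (P : pred I) (F : I -> 'rV[R]_3) v :
  dot (\sum_(i <- r | P i) F i) v = \sum_(i <- r | P i) dot (F i) v.
Proof.
by elim/big_rec2: _ => [|i x y _ <-]; [exact: dot0l|exact: dotDl].
Qed.

Lemma dot_crossE u v : dot (cross u v) (cross u v) =
  dot u u * dot v v - dot u v ^+ 2.
Proof. by rewrite !dotE !vecE; ring. Qed.

Lemma dot_crossr u v : dot (cross u v) v = 0.
Proof. by rewrite !dotE !vecE; ring. Qed.

Lemma cross_eq0 u v : (cross u v == 0) =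
  (dot u u * dot v v == dot u v ^+ 2).
Proof. by rewrite -dot_eq0 dot_crossE subr_eq0. Qed.

Lemma dot_le u v : dot u v <= vnorm u * vnorm v.
Proof.
have := dot_ge0 (cross u v); rewrite dot_crossE -!vnormK.
have := vnorm_ge0 u; have := vnorm_ge0 v => h1 h2 h3.
have h := mulr_ge0 h2 h1; rewrite leNgt; apply/negP => lt_.
suff : vnorm u ^+ 2 * vnorm v ^+ 2 < dot u v ^+ 2 by rewrite ltNge -subr_ge0 h3.
by rewrite -exprMn ltr_pXn2r // nnegrE // ltW // (le_lt_trans h).
Qed.

Lemma dot_add u v :
  dot (u + v) (u + v) = dot u u + dot v v + 2 * dot u v.
Proof. by rewrite !dotE !vecE; ring. Qed.

Lemma vnorm_triangle u v : vnorm (u + v) <= vnorm u + vnorm v.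
Proof.
have h : 0 <= vnorm u + vnorm v by rewrite addr_ge0 ?vnorm_ge0.
rewrite -(ler_pXn2r (_ : 0 < 2)%N) ?nnegrE ?vnorm_ge0 // vnormK.
rewrite dot_add -!vnormK; have := dot_le u v; clear.
by move: (vnorm u) (vnorm v) (dot u v) => p q r; nra.
Qed.

Lemma vnorm_closed u v w : u + v + w = 0 -> vnorm w <= vnorm u + vnorm v.
Proof.
move=> /eqP; rewrite addr_eq0 => /eqP uv; rewrite -vnormN -uv.
exact: vnorm_triangle.
Qed.

(** Heron's formula; the left-hand side is 16 times the squared area. *)
Lemma heron u v w : u + v + w = 0 ->
  4 * dot (cross u v) (cross u v) =
  (vnorm u + vnorm v + vnorm w) *
  ((vnorm u + vnorm v - vnorm w) *
   ((vnorm v + vnorm w - vnorm u) *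
    (vnorm u + vnorm w - vnorm v))).
Proof.
move=> /eqP; rewrite addr_eq0 => /eqP uv.
have hw : vnorm w ^+ 2 = vnorm u ^+ 2 + vnorm v ^+ 2 + 2 * dot u v.
  by rewrite -(vnormN w) -uv 3!vnormK dot_add.
rewrite dot_crossE -!vnormK.
move: hw; move: (vnorm u) (vnorm v) (vnorm w) (dot u v) => p q r d hw; clear uv.
have -> : d = (r ^+ 2 - p ^+ 2 - q ^+ 2) / 2 by rewrite hw; field.
by field.
Qed.

Lemma strict_triangleP u v w : u + v + w = 0 ->
  cross u v != 0 <-> [/\ vnorm w < vnorm u + vnorm v,
    vnorm u < vnorm v + vnorm w & vnorm v < vnorm u + vnorm w].
Proof.
move=> uvw; rewrite -dot_gt0.
have h := heron uvw; have hw := vnorm_closed uvw.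
have hu : vnorm u <= vnorm v + vnorm w.
  by apply: vnorm_closed; rewrite addrC addrA.
have hv : vnorm v <= vnorm u + vnorm w.
  by apply: vnorm_closed; rewrite addrAC.
move: h hw hu hv; move: (vnorm_ge0 u) (vnorm_ge0 v) (vnorm_ge0 w).
move: (vnorm u) (vnorm v) (vnorm w) (dot _ _) => p q r g; clear uvw.
move=> p0 q0 r0 h hr hp hq; split=> [g0|[h1 h2 h3]]; last first.
  rewrite -(pmulr_rgt0 (x := 4)) // h; apply: mulr_gt0; first by lra.
  by apply: mulr_gt0; [lra|apply: mulr_gt0; lra].
have : 4 * g != 0 by lra.
rewrite h !mulf_eq0 !negb_or !subr_eq0 => /and4P[_ n1 n2 n3].
by split; rewrite lt_neqAle ?hr ?hp ?hq andbT eq_sym.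
Qed.

Lemma normalize v : v != 0 -> dot ((vnorm v)^-1 *: v) ((vnorm v)^-1 *: v) = 1.
Proof.
move=> v0; rewrite dotZl dotZr -vnormK.
by field; rewrite vnorm_eq0.
Qed.

(** Either e_0 x w is nonzero, or w is a multiple of e_0, hence orthogonal to
e_1. *)
Lemma unit_orthogonal w : exists2 k, dot k k = 1 & dot k w = 0.
Proof.
suff [k k0 kw] : exists2 k, k != 0 & dot k w = 0.
  exists ((vnorm k)^-1 *: k); first exact: normalize.
  by rewrite dotZl kw mulr0.
have e1 i : cross (delta_mx 0 i) w != 0 ->
    exists2 k, k != 0 & dot k w = 0.
  by move=> h; exists (cross (delta_mx 0 i) w) => //; rewrite dot_crossr.
have [c0|/e1//] := eqVneq (cross (delta_mx 0 0) w) 0.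
exists (delta_mx 0 1).
  by apply/eqP => /rowP/(_ 1); rewrite !mxE /= => /eqP; rewrite oner_eq0.
rewrite dotC dot_delta; have /rowP/(_ 2%:R) := c0.
by rewrite cross2E !mxE /= mul1r mul0r subr0.
Qed.

Lemma unit_orthogonal2 u v : vnorm u = vnorm v ->
  exists2 k, dot k k = 1 & dot k u = 0 /\ dot k v = 0.
Proof.
move=> uv; have [c0|c0] := eqVneq (cross u v) 0; last first.
  exists ((vnorm (cross u v))^-1 *: cross u v); first exact: normalize.
  by rewrite !dotZl !dotE !vecE; split; ring.
have [k k1 ku] := unit_orthogonal u; exists k => //; split=> //.
have [u0|u0] := eqVneq u 0.
  have /eqP : vnorm v = 0 by rewrite -uv; apply/eqP; rewrite vnorm_eq0 u0.
  by rewrite vnorm_eq0 => /eqP ->; rewrite dotC dot0l.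
have : dot (cross u v) (cross u k) =
   dot u u * dot k v - dot k u * dot u v.
  by rewrite !dotE !vecE; ring.
rewrite c0 dot0l ku mul0r subr0 => /esym/eqP.
by rewrite mulf_eq0 dot_eq0 (negbTE u0) => /eqP.
Qed.

Lemma triangle_exists w b c : 0 <= b -> 0 <= c -> `|b - c| <= vnorm w <= b + c ->
  exists u v, [/\ u + v = w, vnorm u = b & vnorm v = c].
Proof.
move=> b0 c0 /andP[h1 h2]; have [w0|w0] := eqVneq w 0.
  have bc : b = c.
    have : `|b - c| <= 0 by move: h1; rewrite w0 !vnormE dot0l sqrtr0.
    by rewrite normr_le0 subr_eq0 => /eqP.
  have [k k1 _] := unit_orthogonal w; exists (b *: k), (- (b *: k)).
  rewrite subrr w0 vnormN -bc; split=> //; apply: vnorm_eq => //;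
  by rewrite dotZl dotZr k1 mulr1 expr2.
have [k k1 kw] := unit_orthogonal w.
have a0 : 0 < vnorm w by rewrite vnorm_gt0.
have ww := vnormK w.
move: h1 h2 ww a0; move: (vnorm w) => a h1 h2 ww a0.
(* the law of cosines gives the component p along w, Pythagoras the height q *)
pose p := (a ^+ 2 + b ^+ 2 - c ^+ 2) / (2 * a ^+ 2).
have hp : p * a ^+ 2 * 2 = a ^+ 2 + b ^+ 2 - c ^+ 2.
  by rewrite /p; field; rewrite gt_eqF.
have q0 : 0 <= b ^+ 2 - p ^+ 2 * a ^+ 2.
  rewrite -(pmulr_rge0 _ (_ : 0 < 4 * a ^+ 2)); last by nra.
  have -> : 4 * a ^+ 2 * (b ^+ 2 - p ^+ 2 * a ^+ 2) =
     ((b + c - a) * (a + b + c)) * ((a - (b - c)) * (a - (c - b))).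
    transitivity (4 * a ^+ 2 * b ^+ 2 - (p * a ^+ 2 * 2) ^+ 2); first by ring.
    by rewrite hp; ring.
  move: h1; rewrite ler_norml => /andP[h3 h4].
  by apply: mulr_ge0; apply: mulr_ge0; lra.
pose q := Num.sqrt (b ^+ 2 - p ^+ 2 * a ^+ 2).
have hq : q ^+ 2 = b ^+ 2 - p ^+ 2 * a ^+ 2 by rewrite sqr_sqrtr.
exists (p *: w + q *: k), (w - (p *: w + q *: k)); split.
- by rewrite addrC subrK.
- apply: vnorm_eq => //; rewrite dotDl !dotDr !dotZl !dotZr.
  rewrite (dotC w k) kw k1 -ww.
  by transitivity (p ^+ 2 * a ^+ 2 + q ^+ 2); [ring|rewrite hq; ring].
- apply: vnorm_eq => //.
  rewrite !dot_lin; rewrite (dotC w k) kw k1 -ww.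
  transitivity (a ^+ 2 - p * a ^+ 2 * 2 + p ^+ 2 * a ^+ 2 + q ^+ 2); first by ring.
  by rewrite hq hp; ring.
Qed.

(** Rodrigues' formula for the rotation of cosine c and sine s about a unit k. *)
Definition rotation k c s v := c *: v + s *: cross k v + ((1 - c) * dot k v) *: k.

Lemma rotationD k c s u v : rotation k c s (u + v) = rotation k c s u + rotation k c s v.
Proof.
rewrite /rotation !dotE; apply: row3P; rewrite !vecE; ring.
Qed.

Lemma rotation0 k c s : rotation k c s 0 = 0.
Proof.
rewrite /rotation !dotE; apply: row3P; rewrite !vecE; ring.
Qed.

Lemma rotation_id k v : rotation k 1 0 v = v.
Proof. by rewrite /rotation scale1r scale0r subrr mul0r scale0r !addr0. Qed.

Lemma rotation_axis k c s a : dot k k = 1 -> rotation k c s (a *: k) = a *: k.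
Proof.
move=> k1; rewrite /rotation crossZr crossvv dotZr k1 !scaler0 addr0 scalerA.
by rewrite -scalerDl; congr (_ *: _); ring.
Qed.

Lemma rotation_dot k c s u v : dot k k = 1 -> c ^+ 2 + s ^+ 2 = 1 ->
  dot (rotation k c s u) (rotation k c s v) = dot u v.
Proof.
move=> k1 cs; rewrite /rotation.
rewrite !dot_lin k1.
have -> : dot u (cross k v) = - dot (cross k u) v.
  by rewrite !dotE !vecE; ring.
have -> : dot (cross k u) (cross k v) = dot u v - dot k u * dot k v.
  transitivity (dot k k * dot u v - dot k u * dot k v).
    by rewrite !dotE !vecE; ring.
  by rewrite k1 mul1r.
have -> : dot (cross k u) k = 0 by rewrite !dotE !vecE; ring.
have -> : dot k (cross k v) = 0 by rewrite !dotE !vecE; ring.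
rewrite (dotC u k).
transitivity ((c ^+ 2 + s ^+ 2) * dot u v + (1 - (c ^+ 2 + s ^+ 2)) * (dot k u * dot k v)).
  by ring.
by rewrite cs; ring.
Qed.

Lemma rotation_norm k c s u : dot k k = 1 -> c ^+ 2 + s ^+ 2 = 1 ->
  vnorm (rotation k c s u) = vnorm u.
Proof. by move=> k1 cs; apply/vnorm_dot; rewrite rotation_dot. Qed.

(** The components p, q of u, v orthogonal to k have the same length, and q has
coordinates of square sum 1 in the orthogonal basis p, k x p of the plane
orthogonal to k, by the value of the Gram determinant of k, p, q. *)
Lemma rotation_about k u v : dot k k = 1 -> vnorm u = vnorm v ->
  dot k u = dot k v ->
  exists c s, c ^+ 2 + s ^+ 2 = 1 /\ rotation k c s u = v.
Proof.
move=> k1 /vnorm_dot uv kuv.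
pose p := u - dot k u *: k; pose q := v - dot k v *: k.
have kp : dot k p = 0 by rewrite dotDr dotNr dotZr k1 mulr1 subrr.
have kq : dot k q = 0 by rewrite dotDr dotNr dotZr k1 mulr1 subrr.
have hu : u = p + dot k u *: k by rewrite subrK.
have hv : v = q + dot k u *: k by rewrite kuv subrK.
move: p q kp kq hu hv => p q kp kq hu hv.
have pq : dot p p = dot q q.
  move: uv; rewrite {1 2}hu {1 2}hv !dot_lin k1.
  by rewrite !(dotC _ k) kp kq; lra.
have gram : dot (cross k p) q ^+ 2 = dot p p * dot q q - dot p q ^+ 2.
  transitivity (dot k k * dot p p * dot q q
    + 2 * dot k p * dot p q * dot k q - dot k k * dot p q ^+ 2
    - dot p p * dot k q ^+ 2 - dot q q * dot k p ^+ 2).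
    by rewrite !dotE !vecE; ring.
  by rewrite k1 kp kq; ring.
suff [c [s [cs rp]]] : exists c s, c ^+ 2 + s ^+ 2 = 1 /\ rotation k c s p = q.
  by exists c, s; split=> //; rewrite hu rotationD rp rotation_axis // -hv.
have [p0|p0] := eqVneq p 0.
  exists 1, 0; rewrite rotation_id expr1n expr0n /= addr0; split=> //.
  by apply/esym/eqP; rewrite p0 -dot_eq0 -pq p0 dot0l.
have d0 : dot p p != 0 by rewrite dot_eq0.
exists (dot p q / dot p p), (dot (cross k p) q / dot p p); split.
  by rewrite !exprMn gram -pq; field.
rewrite /rotation kp mulr0 scale0r addr0.
set r := _ + _; apply/eqP; rewrite -subr_eq0 -dot_eq0.
have ck : dot (cross k p) (cross k p) = dot p p.
  by rewrite dot_crossE k1 kp; ring.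
have pc : dot p (cross k p) = 0 by rewrite !dotE !vecE; ring.
have -> : dot (r - q) (r - q) = dot q q -
   (dot p q ^+ 2 + dot (cross k p) q ^+ 2) / dot p p.
  rewrite /r !dot_lin ck pc (dotC (cross k p) p) pc.
  by rewrite !(dotC q); field.
by rewrite gram -pq; apply/eqP; field.
Qed.

(** The axis is the common side u + v. If it vanishes, every rotation fixes it,
and an axis orthogonal to both u and u' works. *)
Lemma rotation_of_triangle u v u' v' : u + v = u' + v' ->
  vnorm u = vnorm u' -> vnorm v = vnorm v' ->
  exists k c s, [/\ dot k k = 1, c ^+ 2 + s ^+ 2 = 1,
    forall c' s', rotation k c' s' (u + v) = u + v,
    rotation k c s u = u' & rotation k c s v = v'].
Proof.
move=> e hu hv.
suff [k k1 [fix_ ku]] : exists2 k, dot k k = 1 &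
    (forall c' s', rotation k c' s' (u + v) = u + v) /\ dot k u = dot k u'.
  have [c [s [cs ruv]]] := rotation_about k1 hu ku.
  exists k, c, s; split=> //; apply: (addrI (rotation k c s u)).
  by rewrite -rotationD fix_ ruv.
have [w0|w0] := eqVneq (u + v) 0.
  have [k k1 [ku ku']] := unit_orthogonal2 hu; exists k => //; split; last by rewrite ku.
  by move=> c s; rewrite w0 rotation0.
have wu : dot (u + v) u = dot (u + v) u'.
  have h : v = u + v - u by rewrite addrAC subrr add0r.
  have h' : v' = u + v - u' by rewrite e addrAC subrr add0r.
  move: hu hv => /vnorm_dot hu /vnorm_dot; rewrite {1 2}h h'.
  move: (u + v) => w; rewrite !dot_lin.
  by rewrite (dotC u w) (dotC u' w) hu; lra.
exists ((vnorm (u + v))^-1 *: (u + v)); first exact: normalize.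
split=> [c s|]; last by rewrite !dotZl wu.
have h : u + v = vnorm (u + v) *: ((vnorm (u + v))^-1 *: (u + v)).
  by rewrite scalerA divff ?scale1r ?vnorm_eq0.
by have := rotation_axis c s (vnorm (u + v)) (normalize w0); rewrite -h.
Qed.

Lemma parallelE u v : v != 0 -> cross u v = 0 ->
  u = (dot u v / dot v v) *: v.
Proof.
move=> v0 uv; have d0 : dot v v != 0 by rewrite dot_eq0.
have h : cross v (cross u v) = dot v v *: u - dot u v *: v.
  by rewrite !dotE; apply: row3P; rewrite !vecE; ring.
move: h; rewrite uv crossv0 => /esym/eqP; rewrite subr_eq0 => /eqP h.
by rewrite mulrC -scalerA -h scalerA mulVf // scale1r.
Qed.

Lemma parallel_trans u v w : v != 0 -> cross u v = 0 -> cross v w = 0 -> cross u w = 0.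
Proof. by move=> v0 /(parallelE v0) -> vw; rewrite crossZl vw scaler0. Qed.

End Space.

(** * Partial sums of a configuration *)

Section Configurations.
Variables (R : realType) (n : nat).
Implicit Types (z : 'M[R]_(n, 3)) (i j : 'I_n) (I J A B C : {set 'I_n}).
Implicit Types (k : 'rV[R]_3) (c s t : R).

Definition vsum I z : 'rV[R]_3 := \sum_(i in I) row i z.

Definition glue I z z' : 'M[R]_(n, 3) :=
  \matrix_i (if i \in I then row i z else row i z').

Definition rotate_rows I k c s z : 'M[R]_(n, 3) :=
  \matrix_i (if i \in I then rotation k c s (row i z) else row i z).

Lemma row_glue I z z' i : row i (glue I z z') = if i \in I then row i z else row i z'.
Proof. exact: rowK. Qed.

Lemma row_rotate I k c s z i : row i (rotate_rows I k c s z) =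
  if i \in I then rotation k c s (row i z) else row i z.
Proof. exact: rowK. Qed.

Lemma vsum_eq I z z' : (forall i, i \in I -> row i z = row i z') -> vsum I z = vsum I z'.
Proof. by move=> h; apply: eq_bigr. Qed.

Lemma vsumU I J z : (forall i, i \in I -> i \in J -> False) ->
  vsum (I :|: J)%SET z = vsum I z + vsum J z.
Proof.
move=> IJ; rewrite /vsum big_mkcond [X in _ = X + _]big_mkcond.
rewrite [X in _ = _ + X]big_mkcond -big_split /=.
apply: eq_bigr => i _; rewrite inE; have := IJ i.
by case: (i \in I); case: (i \in J) => h; rewrite ?addr0 ?add0r //; case: h.
Qed.

Lemma vsum_set1 i z : vsum [set i]%SET z = row i z.
Proof. exact: big_set1. Qed.

Lemma vsum_rotate I J k c s z : I \subset J ->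
  vsum I (rotate_rows J k c s z) = rotation k c s (vsum I z).
Proof.
move=> /fintype.subsetP IJ; rewrite /vsum.
rewrite (big_morph _ (rotationD k c s) (rotation0 k c s)).
by apply: eq_bigr => i iI; rewrite row_rotate IJ.
Qed.

Lemma rotate_rows_id I k z : rotate_rows I k 1 0 z = z.
Proof.
by apply/row_matrixP => i; rewrite row_rotate rotation_id; case: ifP.
Qed.

Lemma sum_single (V : nmodType) I i (u : V) :
  \sum_(j in I) (if j == i then u else 0) = if i \in I then u else 0.
Proof.
rewrite -big_mkcondr; have [iI|iI] := boolP (i \in I).
  by rewrite (big_pred1 i) // => j /=; case: eqVneq => [->|]; rewrite ?iI ?andbF.
by rewrite big_pred0 // => j /=; case: eqVneq => [->|]; rewrite ?(negbTE iI) ?andbF.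
Qed.

Lemma vsum_shift I z z' i j (delta : 'rV[R]_3) : i != j ->
  row i z' = row i z + delta -> row j z' = row j z - delta ->
  (forall x, x != i -> x != j -> row x z' = row x z) ->
  vsum I z' = vsum I z + ((if i \in I then delta else 0) - (if j \in I then delta else 0)).
Proof.
move=> ij zi zj zo.
have fE x : row x z' = row x z +
    ((if x == i then delta else 0) - (if x == j then delta else 0)).
  have [->|xi] := eqVneq x i; first by rewrite (negbTE ij) subr0.
  have [->|xj] := eqVneq x j; first by rewrite sub0r.
  by rewrite subrr addr0 zo.
by rewrite /vsum (eq_bigr _ (fun x _ => fE x)) !big_split /= sumrN !sum_single.
Qed.

Lemma vsumT z : vsum [set: 'I_n]%SET z = \sum_i row i z.
Proof. by apply: eq_bigl => i; rewrite inE. Qed.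

(** An equation between numbers, because it is symmetric in the three sets. *)
Definition partition3 A B C := (forall i, (i \in A) + (i \in B) + (i \in C) = 1)%N.

Lemma partition3_rot A B C : partition3 A B C -> partition3 B C A.
Proof. by move=> h i; rewrite -(h i) addnC addnA. Qed.

Lemma partition3_swap A B C : partition3 A B C -> partition3 B A C.
Proof. by move=> h i; rewrite -(h i) (addnC (i \in B)). Qed.

Lemma partition3_sum A B C z : partition3 A B C -> \sum_i row i z = 0 ->
  vsum A z + vsum B z + vsum C z = 0.
Proof.
move=> ABC z0; rewrite -[RHS]z0 /vsum.
rewrite big_mkcond [X in _ + X + _]big_mkcond [X in _ + _ + X]big_mkcond -!big_split /=.
apply: eq_bigr => i _; have := ABC i.
by case: (i \in A); case: (i \in B); case: (i \in C) => //= _; rewrite ?addr0 ?add0r.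
Qed.

End Configurations.

(** * Continuity and connected components *)

Section Continuity.
Variable R : realType.

Lemma continuous_mx (T : topologicalType) m p (f : T -> 'M[R]_(m, p)) :
  (forall i j, continuous (fun t => f t i j)) -> continuous f.
Proof.
move=> cf t U [P Pf sU].
have h : \forall t' \near t, forall i j, P i j (f t' i j).
  by apply: filter_forall => i; apply: filter_forall => j; exact/cf/Pf.
by apply: filterS h => t' h; exact: sU.
Qed.

Lemma continuous_vsum n (I : {set 'I_n}) j :
  continuous (fun z : 'M[R]_(n, 3) => vsum I z 0 j).
Proof.
rewrite (_ : (fun _ => _) = fun z : 'M[R]_(n, 3) => \sum_(i in I) z i j).
  by apply: continuous_big; [exact: add_continuous|move=> i _; exact: coord_continuous].
by apply/funext => z; rewrite /vsum summxE; apply: eq_bigr => i _; rewrite mxE.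
Qed.

Lemma continuous_dot (T : topologicalType) (f g : T -> 'rV[R]_3) :
  (forall j, continuous (fun t => f t 0 j)) -> (forall j, continuous (fun t => g t 0 j)) ->
  continuous (fun t => dot (f t) (g t)).
Proof.
move=> cf cg; under eq_fun do rewrite dotE; move=> t.
by apply: cvgD; [apply: cvgD|]; apply: cvgM; (exact: cf || exact: cg).
Qed.

Lemma continuous_vnorm (T : topologicalType) (f : T -> 'rV[R]_3) :
  (forall j, continuous (fun t => f t 0 j)) -> continuous (fun t => vnorm (f t)).
Proof.
move=> cf; under eq_fun do rewrite vnormE; move=> t.
by apply: (@continuous_comp _ _ _ (fun t => dot (f t) (f t)) Num.sqrt);
  [exact: continuous_dot|exact: sqrt_continuous].
Qed.

Lemma continuous_rotate n (I : {set 'I_n}) k (z : 'M[R]_(n, 3)) :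
  continuous (fun t : R => rotate_rows I k (cos t) (sin t) z).
Proof.
apply: continuous_mx => i j.
rewrite (_ : (fun _ => _) = fun t => if i \in I then
   cos t * z i j + sin t * cross k (row i z) 0 j + (1 - cos t) * dot k (row i z) * k 0 j
   else z i j); last first.
  by apply/funext => t; rewrite mxE; case: ifP => _; rewrite !mxE.
case: (i \in I); last by move=> t; exact: cvg_cst.
move=> t; apply: cvgD; first apply: cvgD.
- by apply: cvgM; [exact: continuous_cos|exact: cvg_cst].
- by apply: cvgM; [exact: continuous_sin|exact: cvg_cst].
- apply: cvgM; last exact: cvg_cst.
  by apply: cvgM; [apply: cvgB; [exact: cvg_cst|exact: continuous_cos]|exact: cvg_cst].
Qed.

Lemma circle_angle (c s : R) : c ^+ 2 + s ^+ 2 = 1 -> exists t, cos t = c /\ sin t = s.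
Proof.
move=> cs.
have c1 : -1 <= c <= 1.
  rewrite -ler_norml -(ler_pXn2r (_ : 0 < 2)%N) ?nnegrE // real_normK ?num_real // expr1n.
  by rewrite -cs lerDl sqr_ge0.
have s2 : 1 - c ^+ 2 = s ^+ 2 by rewrite -cs addrAC subrr add0r.
have ca : cos (acos c) = c by apply: acosK; rewrite in_itv.
have sa : sin (acos c) = `|s| by rewrite sin_acos // s2 sqrtr_sqr.
have [s0|s0] := leP 0 s; [exists (acos c)|exists (- acos c)].
  by rewrite ca sa ger0_norm.
by rewrite cosN sinN ca sa ltr0_norm // opprK.
Qed.

End Continuity.

Section Component.
Variable T : topologicalType.
Implicit Types A B : set T.

Lemma connected_component_mono A B x y : A `<=` B ->
  connected_component A x y -> connected_component B x y.
Proof.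
move=> AB [C [Cx CA cC] Cy]; exists C => //; split=> //; exact: subset_trans AB.
Qed.

Lemma connected_by_component A :
  (forall x y, A x -> A y -> connected_component A x y) -> connected A.
Proof.
move=> h; have [->|/set0P[x Ax]] := eqVneq A set0; first exact: connected0.
rewrite (_ : A = connected_component A x); first exact: component_connected.
apply/seteqP; split; first by move=> y Ay; exact: h.
exact: connected_component_sub.
Qed.
End Component.

(** * Gluing and bending triangles along the tree *)

Section Fibers.
Variables (R : realType) (n : nat) (G : half_edge_graph n).
Hypothesis Gadm : admissible G.
Variable len : edge G -> R.
Hypothesis len_ge0 : forall e, 0 <= len e.
Notation L x := (len (xdart_edge x)).
Notation xreach := (connect (@succ_xdart n G)).
Hypothesis len_triangle : forall x y z : xdart G, xdart_src x = xdart_src z ->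
  xdart_src y = xdart_src z -> x != y -> y != z -> x != z ->
  `|L x - L y| <= L z <= L x + L y.
Implicit Types (x y : xdart G) (d : dart G) (z : 'M[R]_(n, 3)).

Definition measured x z := forall y, xreach x y -> vnorm (vsum (branch y) z) = L y.

Lemma measured_eq x z z' : (forall i, i \in branch x -> row i z = row i z') ->
  measured x z -> measured x z'.
Proof.
move=> zz' mz y xy; rewrite -mz //; congr vnorm; apply: vsum_eq => i iy.
by rewrite zz' //; apply: (fintype.subsetP _ _ iy); exact: sub_branch.
Qed.

Lemma measured_half i z : measured (inr i) z <-> vnorm (row i z) = L (inr i).
Proof.
split=> [/(_ _ (connect0 _ _))|h y /reach_xdart_cases ->];
  by rewrite branch_half vsum_set1.
Qed.

Lemma measured_dart d x y z : x != y -> succ_xdart (inl d) x -> succ_xdart (inl d) y ->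
  vnorm (vsum (branch (inl d)) z) = L (inl d) -> measured x z -> measured y z ->
  measured (inl d) z.
Proof.
move=> xy dx dy hd mx my t /reach_xdartE[->//|[u du ut]].
have [x' [y' [_ _ _ h]]] := succ_xdartP Gadm d.
have : u = x \/ u = y.
  by case: (h _ dx) (h _ dy) (h _ du) xy => -> [] -> [] ->; rewrite ?eqxx //; auto.
by case=> uE; subst u; [exact: mx|exact: my].
Qed.

Lemma measured_sub x y z : xreach x y -> measured x z -> measured y z.
Proof. by move=> xy mx u yu; apply: mx; exact: connect_trans yu. Qed.

Lemma measured_rotate (I : {set 'I_n}) x z k (c s : R) : branch x \subset I ->
  dot k k = 1 -> c ^+ 2 + s ^+ 2 = 1 -> measured x z ->
  measured x (rotate_rows I k c s z).
Proof.
move=> xI k1 cs mx y xy.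
have yI := fintype.subset_trans (sub_branch xy) xI.
by rewrite (vsum_rotate _ _ _ _ yI) rotation_norm // mx.
Qed.

Lemma succ_triangle d x y : x != y -> succ_xdart (inl d) x -> succ_xdart (inl d) y ->
  `|L x - L y| <= L (inl d) <= L x + L y.
Proof.
move=> xy dx dy; have := @len_triangle x y (inl (rev_dart d)).
rewrite (succ_xdart_src dx) (succ_xdart_src dy) /= dart_src_rev; apply=> //.
  by case/andP: dy.
by case/andP: dx.
Qed.

Definition disjoint_branches x y := forall i, i \in branch x -> i \in branch y -> False.

Lemma succ_disjoint d x y : x != y -> succ_xdart (inl d) x -> succ_xdart (inl d) y ->
  disjoint_branches x y.
Proof.
move=> xy dx dy i; apply: (branch_disjoint Gadm) => //.
by rewrite (succ_xdart_src dx) (succ_xdart_src dy).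
Qed.

Definition realizable x := forall w, vnorm w = L x ->
  exists2 z, measured x z & vsum (branch x) z = w.

Lemma realize_pair x y u v : disjoint_branches x y -> realizable x -> realizable y ->
  vnorm u = L x -> vnorm v = L y -> exists z,
  [/\ measured x z, measured y z, vsum (branch x) z = u & vsum (branch y) z = v].
Proof.
move=> dis rx ry /rx[zx mx sx] /ry[zy my sy]; exists (glue (branch x) zx zy).
have ex i : i \in branch x -> row i zx = row i (glue (branch x) zx zy).
  by move=> ix; rewrite row_glue ix.
have ey i : i \in branch y -> row i zy = row i (glue (branch x) zx zy).
  by move=> iy; rewrite row_glue ifN //; apply/negP => ix; exact: dis ix iy.
split; [exact: measured_eq mx|exact: measured_eq my| |].
  by rewrite -(vsum_eq ex).
by rewrite -(vsum_eq ey).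
Qed.

Lemma realize x : realizable x.
Proof.
elim/(xdart_ind Gadm): x => [i|d IH] w hw.
  exists (\matrix_(j < n) w); last by rewrite branch_half vsum_set1 rowK.
  by apply/measured_half; rewrite rowK.
have [x [y [xy dx dy _]]] := succ_xdartP Gadm d.
have tri : `|L x - L y| <= vnorm w <= L x + L y by rewrite hw succ_triangle.
have [u [v [uvw hu hv]]] := triangle_exists (len_ge0 _) (len_ge0 _) tri.
have dis := succ_disjoint xy dx dy.
have [z [mx my sx sy]] := realize_pair dis (IH _ dx) (IH _ dy) hu hv.
have sd : vsum (branch (inl d)) z = w.
  by rewrite (succ_branchU Gadm xy dx dy) vsumU // sx sy.
by exists z => //; apply: measured_dart xy dx dy _ mx my; rewrite sd.
Qed.

(** The configurations that can be reached from z0 by bending beyond x only. *)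
Definition shape x z0 : set 'M[R]_(n, 3) := [set z | [/\ measured x z,
  vsum (branch x) z = vsum (branch x) z0 & forall i, i \notin branch x -> row i z = row i z0]].

(** The same for two branches x and y bent together, with a fixed total sum. *)
Definition shape2 x y z0 : set 'M[R]_(n, 3) := [set z | [/\ measured x z, measured y z,
  vsum (branch x) z + vsum (branch y) z = vsum (branch x) z0 + vsum (branch y) z0 &
  forall i, i \notin branch x -> i \notin branch y -> row i z = row i z0]].

Definition bendable x := forall z z', measured x z -> shape x z z' ->
  connected_component (shape x z) z z'.

(** First rotate both branches about their total sum until the partial sums over
x and over y are those of z'; then bend x alone, which leads to the hybrid h of
z' on x and the rotated z elsewhere, and finally y alone. *)
Lemma bend_pair x y z z' : disjoint_branches x y -> bendable x -> bendable y ->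
  measured x z -> measured y z -> shape2 x y z z' ->
  connected_component (shape2 x y z) z z'.
Proof.
move=> dis bx by_ mx my [mx' my' szz' ozz'].
have dis' i : i \in branch y -> i \notin branch x.
  by move=> iy; apply/negP => ix; exact: dis ix iy.
have [||k [c [s [k1 cs fix_ ru rv]]]] := rotation_of_triangle (esym szz').
- by rewrite mx ?mx' ?connect0.
- by rewrite my ?my' ?connect0.
have [t [ct st]] := circle_angle cs; subst c s.
pose I := (branch x :|: branch y)%SET.
have xI : branch x \subset I by exact: finset.subsetUl.
have yI : branch y \subset I by exact: finset.subsetUr.
pose rot t := rotate_rows I k (cos t) (sin t) z.
have outI i t0 : i \notin branch x -> i \notin branch y -> row i (rot t0) = row i z.
  by move=> ix iy; rewrite row_rotate inE (negbTE ix) (negbTE iy).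
have mxr t0 : measured x (rot t0) by apply: measured_rotate => //; exact: cos2Dsin2.
have myr t0 : measured y (rot t0) by apply: measured_rotate => //; exact: cos2Dsin2.
have sxr t0 : vsum (branch x) (rot t0) = rotation k (cos t0) (sin t0) (vsum (branch x) z).
  exact: vsum_rotate.
have syr t0 : vsum (branch y) (rot t0) = rotation k (cos t0) (sin t0) (vsum (branch y) z).
  exact: vsum_rotate.
have s2r t0 : vsum (branch x) (rot t0) + vsum (branch y) (rot t0) =
    vsum (branch x) z + vsum (branch y) z.
  by rewrite sxr syr -rotationD fix_.
have z_rot : connected_component (shape2 x y z) z (rot t).
  exists (rot @` [set: R]); last by exists t.
  split; first by exists 0 => //; rewrite /rot cos0 sin0 rotate_rows_id.
    by move=> _ [t0 _ <-]; split=> // i; exact: outI.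
  apply: connected_continuous_connected; first exact/connected_intervalP.
  exact/continuous_subspaceT/continuous_rotate.
pose h := glue (branch x) z' (rot t).
have hx i : i \in branch x -> row i z' = row i h by move=> ix; rewrite row_glue ix.
have hnx i : i \notin branch x -> row i (rot t) = row i h.
  by move=> ix; rewrite row_glue (negbTE ix).
apply: connected_component_trans z_rot _.
apply: (@connected_component_trans _ _ h).
  apply: (connected_component_mono (A := shape x (rot t))).
    move=> w [mw sw ow]; split=> //.
    - by apply: measured_eq (myr t) => i /dis' ix; rewrite ow.
    - rewrite -(s2r t) sw; congr (_ + _); apply: vsum_eq => i /dis' ix; exact: ow.
    - by move=> i ix iy; rewrite ow // outI.
  apply: bx => //; split; first exact: measured_eq mx'.
    by rewrite -(vsum_eq hx) sxr ru.
  by move=> i ix; rewrite hnx.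
apply: (connected_component_mono (A := shape y h)).
  move=> w [mw sw ow]; split=> //.
  - by apply: measured_eq mx' => i ix; rewrite ow ?hx //; apply/negP; exact: dis ix.
  - rewrite sw -(s2r t); congr (_ + _); last by apply: vsum_eq => i /dis' /hnx ->.
    rewrite sxr ru; apply: vsum_eq => i ix.
    by rewrite ow ?hx //; apply/negP; exact: dis ix.
  - by move=> i ix iy; rewrite ow // -hnx // outI.
apply: by_; first by apply: measured_eq (myr t) => i /dis' /hnx.
split=> //.
  by rewrite -rv -syr; apply: vsum_eq => i /dis' /hnx ->.
move=> i iy; have [ix|ix] := boolP (i \in branch x); first exact: hx.
by rewrite -hnx // outI // ozz'.
Qed.

Lemma bend x : bendable x.
Proof.
elim/(xdart_ind Gadm): x => [i|d IH] z z' mz [mz' szz' ozz'].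
  suff -> : z' = z by apply: connected_component_refl; split.
  apply/row_matrixP => j; have [->|ji] := eqVneq j i.
    by move: szz'; rewrite branch_half !vsum_set1.
  by rewrite ozz' // branch_half inE.
have [x [y [xy dx dy _]]] := succ_xdartP Gadm d.
have dis := succ_disjoint xy dx dy.
have dxy := succ_branchU Gadm xy dx dy.
apply: (connected_component_mono (A := shape2 x y z)).
  move=> w [mx my sw ow].
  have sdw : vsum (branch (inl d)) w = vsum (branch (inl d)) z by rewrite dxy !vsumU.
  split=> //; last by move=> i; rewrite dxy inE negb_or => /andP[]; exact: ow.
  by apply: measured_dart xy dx dy _ mx my; rewrite sdw mz ?connect0.
have dx' := connect1 dx; have dy' := connect1 dy.
apply: bend_pair => //; try exact: IH; try exact: measured_sub mz.
split; try exact: measured_sub mz'; first by rewrite -!vsumU // -dxy.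
by move=> i ix iy; rewrite ozz' // dxy inE negb_or ix.
Qed.

End Fibers.

(** * Image and fibers of the length map *)

Section Moment.
Variables (R : realType) (n : nat) (G : half_edge_graph n) (l : 'I_n -> R).
Hypothesis Gadm : admissible G.
Implicit Types (x y : xdart G) (z : 'M[R]_(n, 3)).

Definition edge_length (d : iedge G -> R) (e : edge G) : R :=
  match e with inl a => d a | inr i => l i end.

Definition triangle_weak (len : edge G -> R) := forall x y w : xdart G,
  xdart_src x = xdart_src w -> xdart_src y = xdart_src w -> x != y -> y != w -> x != w ->
  `|len (xdart_edge x) - len (xdart_edge y)| <= len (xdart_edge w)
    <= len (xdart_edge x) + len (xdart_edge y).

Definition triangle_strict (len : edge G -> R) := forall x y w : xdart G,
  xdart_src x = xdart_src w -> xdart_src y = xdart_src w -> x != y -> y != w -> x != w ->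
  len (xdart_edge w) < len (xdart_edge x) + len (xdart_edge y).

Lemma DeltaP (len : edge G -> R) :
  Delta len <-> (forall e, 0 <= len e) /\ triangle_weak len.
Proof.
split=> -[len0 tri]; split=> //.
  move=> x y w xw yw nxy nyw nxw.
  have inc u : xdart_src u = xdart_src w -> incident (xdart_edge u) (xdart_src w).
    by move=> uw; apply/incidentP; exists u.
  have inj (u v : xdart G) : xdart_src u = xdart_src v -> u != v -> xdart_edge u != xdart_edge v.
    by move=> uv; apply: contraNneq => e; rewrite (xdart_edge_inj Gadm uv e).
  by apply: (tri (xdart_src w)); rewrite ?inc ?inj // xw.
move=> v a b c /incidentP[x xv <-] /incidentP[y yv <-] /incidentP[w wv <-] ab bc ac.
apply: tri; rewrite ?xv ?yv ?wv //.
- by apply: contra_neq ab => ->.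
- by apply: contra_neq bc => ->.
- by apply: contra_neq ac => ->.
Qed.

Lemma edge_dart (e : edge G) : exists x : xdart G, xdart_edge x = e.
Proof. by case: e => [a|i]; [exists (inl (a, true))|exists (inr i)]. Qed.

Lemma triangle_strict_gt0 (len : edge G -> R) : triangle_strict len ->
  forall e, 0 < len e.
Proof.
move=> tri e; have [w <-] := edge_dart e.
have [x [y [u [xv yv uv [xy yu xu]]]]] := xdart_srcP Gadm (xdart_src w).
suff [x' [y' [xw yw nxy nyw nxw]]] : exists x' y', [/\ xdart_src x' = xdart_src w,
    xdart_src y' = xdart_src w, x' != y', y' != w & x' != w].
  have := tri x' w y'; have := tri y' w x'; rewrite xw yw eq_sym nxy (eq_sym w).
  move=> /(_ erefl erefl nyw) h1 /(_ erefl erefl nxw) h2.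
  have {}h1 : len (xdart_edge x') < len (xdart_edge y') + len (xdart_edge w).
    by apply: h1 => //; rewrite eq_sym.
  have {}h2 : len (xdart_edge y') < len (xdart_edge x') + len (xdart_edge w).
    by apply: h2 => //; rewrite eq_sym.
  by move: h1 h2; lra.
have [|||->|->|->] := xdart_src_three Gadm (t := w) _ _ _ xy yu xu; rewrite ?xv ?yv ?uv //.
- by exists y, u; rewrite yv uv !(eq_sym _ x).
- by exists x, u; rewrite xv uv (eq_sym u).
- by exists x, y; rewrite xv yv.
Qed.

Lemma triangle_strictW len : triangle_strict len -> triangle_weak len.
Proof.
move=> tri x y w xw yw nxy nyw nxw; rewrite ler_norml.
have h1 := tri x y w xw yw nxy nyw nxw.
have h2 := tri y w x; have h3 := tri x w y.
rewrite xw yw in h2 h3.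
have {}h2 := h2 erefl erefl nyw; rewrite eq_sym nxw eq_sym nxy in h2.
have {}h3 := h3 erefl erefl nxw; rewrite (eq_sym w) nyw nxy in h3.
by have {h2} := h2 isT isT; have {h3} := h3 isT isT; move: h1; lra.
Qed.

Definition diagonals z : iedge G -> R := fun a => diagonal_length a z.

Lemma diagonal_lengthE (a : iedge G) z :
  diagonal_length a z = vnorm (vsum (half_edges_behind a) z).
Proof. by rewrite /diagonal_length vnorm.unlock. Qed.

Lemma closed_polygonsP z : closed_polygons l z <->
  (forall i, vnorm (row i z) = l i) /\ \sum_i row i z = 0.
Proof. by rewrite /closed_polygons /sphere /= vnorm.unlock. Qed.

Lemma vsum_setC (I : {set 'I_n}) z : vsum I z + vsum (~: I) z = \sum_i row i z.
Proof.
rewrite (bigID (fun i => i \in I)) /=; congr (_ + _).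
by apply: eq_bigl => i; rewrite inE.
Qed.

Lemma vnorm_branch_dart (d : dart G) z : \sum_i row i z = 0 ->
  vnorm (vsum (branch (inl d)) z) = diagonal_length d.1 z.
Proof.
case: d => a b z0; rewrite (branch_behind Gadm) diagonal_lengthE /=; case: b => //.
have /eqP := vsum_setC (half_edges_behind a) z; rewrite z0 addrC addr_eq0 => /eqP ->.
by rewrite vnormN.
Qed.

Lemma vnorm_branch x z : closed_polygons l z ->
  vnorm (vsum (branch x) z) = edge_length (diagonals z) (xdart_edge x).
Proof.
move=> /closed_polygonsP[zl z0]; case: x => [d|i]; first exact: vnorm_branch_dart.
by rewrite branch_half vsum_set1 zl.
Qed.

Lemma measured_polygon x z : closed_polygons l z ->
  measured (edge_length (diagonals z)) x z.
Proof. by move=> cz y _; exact: vnorm_branch. Qed.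

Lemma vsum_vertex x y w z : \sum_i row i z = 0 -> xdart_src x = xdart_src w ->
  xdart_src y = xdart_src w -> x != y -> y != w -> x != w ->
  vsum (branch x) z + vsum (branch y) z + vsum (branch w) z = 0.
Proof.
move=> z0 xw yw nxy nyw nxw; apply: partition3_sum z0 => i.
exact: branch_partition.
Qed.

Lemma polygon_Delta z : closed_polygons l z ->
  Delta (edge_length (diagonals z)).
Proof.
move=> cz; have [_ z0] := (closed_polygonsP z).1 cz; apply/DeltaP; split.
  by move=> e; have [x <-] := edge_dart e; rewrite -vnorm_branch // vnorm_ge0.
move=> x y w xw yw nxy nyw nxw; rewrite -!vnorm_branch //.
have s0 := vsum_vertex z0 xw yw nxy nyw nxw.
have := vnorm_closed s0.
have : vnorm (vsum (branch y) z) <= vnorm (vsum (branch x) z) + vnorm (vsum (branch w) z).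
  by apply: vnorm_closed; rewrite addrAC.
have : vnorm (vsum (branch x) z) <= vnorm (vsum (branch y) z) + vnorm (vsum (branch w) z).
  by apply: vnorm_closed; rewrite addrC addrA.
by rewrite ler_norml; clear; lra.
Qed.

Lemma lambda_repr (p : polygon_space l) :
  exists2 z : closed_polygons l, p = polygon_class z &
    lambda G p = diagonals (\val z).
Proof. by exists (repr p); [rewrite /polygon_class reprK|]. Qed.

Lemma lambda_Delta (p : polygon_space l) : Delta_l l G (lambda G p).
Proof.
have [z _ ->] := lambda_repr p.
exact: (polygon_Delta (set_mem (valP z))).
Qed.

(** Prescribing the lengths on both sides of one edge prescribes all of them. *)
Lemma measured_closed (d0 : dart G) d z : \sum_i row i z = 0 ->
  measured (edge_length d) (inl d0) z -> measured (edge_length d) (inl (rev_dart d0)) z ->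
  closed_polygons l z /\ diagonals z = d.
Proof.
move=> z0 m0 m1; split.
  apply/closed_polygonsP; split=> // i.
  have : i \in branch (inl d0) \/ i \in branch (inl (rev_dart d0)).
    by rewrite (branch_rev Gadm) finset.in_setC; case: (i \in _); [left|right].
  rewrite -(vsum_set1 i) -(branch_half G) inE [i \in branch (inl (rev_dart _))]inE.
  by case=> r; [exact: m0 r|exact: m1 r].
apply/funext => a; have [e [ea]] := reach_edge Gadm d0 a.
by rewrite -ea /diagonals -vnorm_branch_dart // => -[] /reach_xdart_inl; [exact: m0|exact: m1].
Qed.

Lemma rev_disjoint (d0 : dart G) : disjoint_branches (inl d0) (inl (rev_dart d0)).
Proof. by move=> i; rewrite (branch_rev Gadm) !inE => ->. Qed.

Lemma rev_vsum (d0 : dart G) z :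
  vsum (branch (inl d0)) z + vsum (branch (inl (rev_dart d0))) z = \sum_i row i z.
Proof. by rewrite (branch_rev Gadm) vsum_setC. Qed.

Lemma Delta_lambda d : (4 <= n)%N -> Delta_l l G d -> exists p : polygon_space l, lambda G p = d.
Proof.
move=> n4 /(DeltaP (edge_length d))[len0 tri]; have [a _] := dart_exists Gadm n4.
have [w hw] : exists w : 'rV[R]_3, vnorm w = d a.
  have [k k1 _] := unit_orthogonal (0 : 'rV[R]_3); exists (d a *: k).
  by apply: vnorm_eq; rewrite ?(len0 (inl a)) // dotZl dotZr k1 mulr1 expr2.
have [z [m0 m1 s0 s1]] := realize_pair (@rev_disjoint (a, true))
  (@realize _ _ _ Gadm _ len0 tri _) (@realize _ _ _ Gadm _ len0 tri _) hw (etrans (vnormN w) hw).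
have z0 : \sum_i row i z = 0 by rewrite -(rev_vsum (a, true)) s0 s1 subrr.
have [cz dz] := measured_closed z0 m0 m1.
exists (polygon_class (exist _ z (mem_set cz))).
by apply/funext => b; rewrite lambdaE -dz.
Qed.

Definition length_fiber (d : iedge G -> R) : set 'M[R]_(n, 3) :=
  [set z | closed_polygons l z /\ diagonals z = d].

Lemma length_fiber_connected d : (4 <= n)%N -> connected (length_fiber d).
Proof.
move=> n4; have [a _] := dart_exists Gadm n4; pose d0 : dart G := (a, true).
apply: connected_by_component => z z' [cz dz] [cz' dz'].
have [_ z0] := (closed_polygonsP z).1 cz; have [_ z0'] := (closed_polygonsP z').1 cz'.
have mz x : measured (edge_length d) x z by rewrite -dz; exact: measured_polygon.
have mz' x : measured (edge_length d) x z' by rewrite -dz'; exact: measured_polygon.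
apply: (connected_component_mono (A := shape2 (edge_length d) (inl d0) (inl (rev_dart d0)) z)).
  move=> w [m0 m1 sw _]; apply: measured_closed m0 m1.
  by rewrite -(rev_vsum d0) sw rev_vsum.
apply: bend_pair => //; [exact: rev_disjoint|exact: bend|exact: bend|].
split=> //; first by rewrite !rev_vsum z0.
by move=> i i0; rewrite (branch_rev Gadm) finset.in_setC i0.
Qed.

Lemma pi_polygon_continuous : continuous (@polygon_class R n l).
Proof. exact: pi_continuous. Qed.

Lemma lambda_fiber_connected d : (4 <= n)%N ->
  connected (@lambda R n l G @^-1` [set d]).
Proof.
move=> n4; have [->|/set0P[p0 _]] := eqVneq (@lambda R n l G @^-1` [set d]) set0.
  exact: connected0.
(* the class map, extended to all configurations; it is continuous on the closed
polygons, where the fiber upstairs lives *)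
pose K z : polygon_space l := match pselect (closed_polygons l z) with
  | left cz => polygon_class (exist _ z (mem_set cz)) | right _ => p0 end.
have KE (z : closed_polygons l) : K (\val z) = polygon_class z.
  rewrite /K; case: pselect => [cz|[]]; last exact: (set_mem (valP z)).
  by congr polygon_class; apply: val_inj.
have -> : @lambda R n l G @^-1` [set d] = K @` length_fiber d.
  apply/seteqP; split=> [p /= pd|_ [z [cz dz] <-] /=].
    have [z pz lz] := lambda_repr p; exists (\val z); last by rewrite KE.
    by split; [exact: (set_mem (valP z))|rewrite -lz pd].
  rewrite (KE (exist _ z (mem_set cz))); apply/funext => a.
  by rewrite lambdaE -dz.
apply: connected_continuous_connected; first exact: length_fiber_connected.
apply: (continuous_subspaceW (B := closed_polygons l)); first by move=> z [].
apply/subspace_sigL_continuousP.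
rewrite (_ : sigL _ _ = @polygon_class R n l); first exact: pi_polygon_continuous.
by apply/funext => z; rewrite -KE.
Qed.

(** * Interior of the polyhedron *)

Lemma continuous_ptws (T : topologicalType) (I : Type) (f : T -> {ptws I -> R}) :
  (forall i, continuous (fun t => f t i : R)) -> continuous f.
Proof.
move=> cf t; apply/cvg_sup => i U [_ [[W oW <-]] /= Wft].
by move=> /filterS; apply; apply: (cf i); exact: open_nbhs_nbhs.
Qed.

Lemma lambda_continuous : continuous (@lambda R n l G).
Proof.
apply/quotient_continuous; apply: continuous_ptws => a.
rewrite (_ : (fun _ => _) =
    (fun z => vnorm (vsum (half_edges_behind a) z)) \o @set_val _ (closed_polygons l)).
  move=> z; apply: (@continuous_comp _ _ _ (@set_val _ (closed_polygons l))).
    exact: initial_continuous.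
  by apply: continuous_vnorm => j; exact: continuous_vsum.
apply/funext => z; transitivity (lambda G (polygon_class z) a) => //.
by rewrite lambdaE diagonal_lengthE.
Qed.

Lemma triangle_strict_interior (d : {ptws iedge G -> R}) :
  triangle_strict (edge_length d) -> (Delta_l l G)° d.
Proof.
move=> tri; rewrite /interior /=.
have ev (e : edge G) : continuous (fun d' : {ptws iedge G -> R} => edge_length d' e).
  by case: e => [a|i]; [exact: (@proj_continuous _ (fun=> R))|exact: cst_continuous].
pose P (t : xdart G * xdart G * xdart G) (d' : {ptws iedge G -> R}) :=
  edge_length d (xdart_edge t.2) <
    edge_length d (xdart_edge t.1.1) + edge_length d (xdart_edge t.1.2) ->
  edge_length d' (xdart_edge t.2) <
    edge_length d' (xdart_edge t.1.1) + edge_length d' (xdart_edge t.1.2).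
have : nbhs d (fun d' => forall t, P t d').
  refine (@filter_forall _ (xdart G * xdart G * xdart G)%type P _ (nbhs_filter d) _) => t.
  rewrite /P.
  have [lt_|nlt] := boolP (edge_length d (xdart_edge t.2) <
     edge_length d (xdart_edge t.1.1) + edge_length d (xdart_edge t.1.2)); last first.
    by apply: nearW.
  pose f d' := edge_length d' (xdart_edge t.1.1) + edge_length d' (xdart_edge t.1.2)
    - edge_length d' (xdart_edge t.2).
  have cf : continuous (f : {ptws iedge G -> R} -> R).
    by move=> d'; exact: (cvgB (cvgD (ev _ d') (ev _ d')) (ev _ d')).
  have pos : nbhs (f d) [set r : R | 0 < r].
    by apply: open_nbhs_nbhs; split; [exact: open_gt|rewrite /= /f subr_gt0].
  apply: (@filterS _ _ (nbhs_filter d) _ _ _ (cf d _ pos)) => d' /=.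
  by rewrite /f subr_gt0.
apply: (@filterS _ _ (nbhs_filter d)) => d' h; suff tri' : triangle_strict (edge_length d').
  apply/(DeltaP (edge_length d')); split; last exact: triangle_strictW.
  by move=> e; apply/ltW/triangle_strict_gt0.
by move=> x y w xw yw nxy nyw nxw; apply: (h (x, y, w)); exact: tri.
Qed.

(** Near an equality d_w = d_x + d_y, moving the length of the internal edge
among x, y, w in the right direction leaves the polyhedron. *)
Lemma interior_triangle_strict (d : {ptws iedge G -> R}) : (4 <= n)%N -> (Delta_l l G)° d ->
  triangle_strict (edge_length d).
Proof.
move=> n4 dint x y w xw yw nxy nyw nxw.
have inj (u v : xdart G) : xdart_src u = xdart_src v -> u != v -> xdart_edge u != xdart_edge v.
  by move=> uv; apply: contraNneq => e; rewrite (xdart_edge_inj Gadm uv e).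
have [a ha] := internal_at Gadm n4 xw yw nxy nyw nxw.
pose f t : {ptws iedge G -> R} := fun b => d b + (b == a)%:R * t.
have fE t e : edge_length (f t) e = edge_length d e + (e == inl a)%:R * t.
  by case: e => [b|i] //=; rewrite mul0r addr0.
have cf : continuous f.
  apply: continuous_ptws => b t; apply: cvgD; first exact: cvg_cst.
  by apply: cvgM; [exact: cvg_cst|exact: cvg_id].
have f0 : f 0 = d by apply/funext => b; rewrite /f mulr0 addr0.
have : \forall t \near (0 : R), Delta_l l G (f t) by apply: cf; rewrite f0.
move=> /nbhs_ballP[e /= e0 sub].
have in_ball t : `|t| < e -> triangle_weak (edge_length (f t)).
  move=> te; suff /(DeltaP (edge_length (f t)))[] : Delta_l l G (f t) by [].
  by apply: sub; rewrite /ball /= sub0r normrN.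
have e2 : `|e / 2| < e by rewrite gtr0_norm; lra.
have e2' : `|- (e / 2)| < e by rewrite normrN.
have exy : xdart_edge x != xdart_edge y by apply: inj; rewrite ?xw.
have eyw := inj _ _ yw nyw; have exw := inj _ _ xw nxw.
have := in_ball _ e2 x y w xw yw nxy nyw nxw.
have := in_ball _ e2' x y w xw yw nxy nyw nxw.
rewrite !fE => /andP[_ h1] /andP[_ h2].
have two u v : xdart_edge u != xdart_edge v ->
    ~~ ((xdart_edge u == inl a) && (xdart_edge v == inl a)).
  by apply: contra => /andP[/eqP -> /eqP ->].
have one : [|| xdart_edge x == inl a, xdart_edge y == inl a | xdart_edge w == inl a].
  by case: ha => ->; rewrite eqxx ?orbT.
move: (two _ _ exy) (two _ _ eyw) (two _ _ exw) one h1 h2.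
case: (_ x == _); case: (_ y == _); case: (_ w == _) => //= _ _ _ _;
  rewrite ?mul0r ?mul1r; lra.
Qed.

Lemma vnorm_branch_lambda (z : closed_polygons l) x :
  vnorm (vsum (branch x) (\val z)) =
  edge_length (lambda G (polygon_class z)) (xdart_edge x).
Proof.
rewrite vnorm_branch; last exact: (set_mem (valP z)).
by case: (xdart_edge x) => [a|//]; exact: (esym (lambdaE z a)).
Qed.

Lemma regular_cross (z : closed_polygons l) x y : (4 <= n)%N ->
  regular_polygons l G (polygon_class z) -> xdart_src x = xdart_src y -> x != y ->
  cross (vsum (branch x) (\val z)) (vsum (branch y) (\val z)) != 0.
Proof.
move=> n4 /(interior_triangle_strict n4) tri xy nxy.
have cz := set_mem (valP z); have [_ z0] := (closed_polygonsP _).1 cz.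
have [w [wy nyw nxw]] := xdart_third Gadm xy nxy.
have xw : xdart_src x = xdart_src w by rewrite wy.
apply/(strict_triangleP (vsum_vertex z0 xw (esym wy) nxy nyw nxw)).
rewrite !vnorm_branch_lambda; split.
- exact: tri.
- by apply: (tri y w x); rewrite ?xw // eq_sym.
- by apply: (tri x w y); rewrite // eq_sym.
Qed.

Lemma cross_regular (z : closed_polygons l) :
  (forall x y, xdart_src x = xdart_src y -> x != y ->
    cross (vsum (branch x) (\val z)) (vsum (branch y) (\val z)) != 0) ->
  regular_polygons l G (polygon_class z).
Proof.
move=> h; apply: triangle_strict_interior.
have cz := set_mem (valP z); have [_ z0] := (closed_polygonsP _).1 cz.
move=> x y w xw yw nxy nyw nxw; rewrite -!vnorm_branch_lambda.
have := h x y; rewrite xw yw => /(_ erefl nxy).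
by case/(strict_triangleP (vsum_vertex z0 xw yw nxy nyw nxw)).
Qed.

End Moment.

(** * Small moves to nondegenerate polygons *)

Section Density.
Variables (R : realType) (n : nat) (l : 'I_n -> R).
Hypothesis l_gt0 : forall i, 0 < l i.
Hypothesis l_lt : forall j, l j < 2^-1 * \sum_i l i.
Implicit Types (z : 'M[R]_(n, 3)) (i j : 'I_n) (I J A B C : {set 'I_n}).
Implicit Types (u v : 'rV[R]_3) (e : R).

Definition row_close e z z' := forall i, vnorm (row i z' - row i z) < e.

Lemma row_close_trans e1 e2 z1 z2 z3 : row_close e1 z1 z2 -> row_close e2 z2 z3 ->
  row_close (e1 + e2) z1 z3.
Proof.
move=> h12 h23 i; have := vnorm_triangle (row i z2 - row i z1) (row i z3 - row i z2).
rewrite addrC addrA subrK => /le_lt_trans; apply; exact: ltrD.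
Qed.

Lemma row_close_refl e z : 0 < e -> row_close e z z.
Proof.
move=> e0 i; rewrite subrr (_ : vnorm 0 = 0) //.
by apply/eqP; rewrite vnorm_eq0.
Qed.

Lemma row_close_le e e' z z' : e <= e' -> row_close e z z' -> row_close e' z z'.
Proof. by move=> ee' h i; exact: lt_le_trans ee'. Qed.

Lemma coord_le_vnorm v (j : 'I_3) : `|v 0 j| <= vnorm v.
Proof.
rewrite -(ler_pXn2r (_ : 0 < 2)%N) ?nnegrE ?vnorm_ge0 // vnormK real_normK ?num_real //.
rewrite dotE; have := sqr_ge0 (v 0 0); have := sqr_ge0 (v 0 1); have := sqr_ge0 (v 0 2%:R).
case: j => [[|[|[|//]]] hj].
- by rewrite (_ : Ordinal hj = 0) -?expr2; [lra|exact/val_inj].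
- by rewrite (_ : Ordinal hj = 1) -?expr2; [lra|exact/val_inj].
- by rewrite (_ : Ordinal hj = 2%:R) -?expr2; [lra|exact/val_inj].
Qed.

Lemma row_close_ball e z z' : 0 < e -> row_close e z z' -> ball z e z'.
Proof.
move=> e0 h; split=> // i j; rewrite /ball /= distrC.
by apply: le_lt_trans (h i); have := coord_le_vnorm (row i z' - row i z) j; rewrite !mxE.
Qed.

(** The positive t_i add up to half the sum of all l_i, and one of them alone is
too short for that. *)
Lemma two_positive (t : 'I_n -> R) (i0 : 'I_n) : \sum_i t i = 0 ->
  (forall i, `|t i| = l i) -> exists i k, [/\ i != k, 0 < t i & 0 < t k].
Proof.
move=> t0 tl.
have sl : \sum_i (`|t i| + t i) = \sum_i l i.
  by rewrite big_split /= t0 addr0; apply: eq_bigr.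
have np i : t i <= 0 -> `|t i| + t i = 0 by move=> ?; rewrite ler0_norm // addNr.
have [[i ti]|no] := pselect (exists i, 0 < t i); last first.
  have := l_lt i0; have := l_gt0 i0; rewrite -sl big1 ?mulr0; first by lra.
  by move=> i _; apply: np; rewrite leNgt; apply/negP => ti; apply: no; exists i.
have [[k [ik tk]]|no] := pselect (exists k, i != k /\ 0 < t k); first by exists i, k.
have := l_lt i; rewrite -sl (bigD1 i) //= big1 ?addr0.
  by rewrite -tl gtr0_norm //; lra.
move=> k ki; apply: np; rewrite leNgt; apply/negP => tk; apply: no; exists k.
by rewrite eq_sym.
Qed.

(** Two sides a u and b u on a ray open up to a genuine triangle when their sum is
shortened by h; by the law of cosines they move by O(sqrt h), with
|p - a u|^2 = a h (2 b - h) / (a + b - h). *)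
Lemma squeeze (a b : R) u e : 0 < a -> 0 < b -> dot u u = 1 -> 0 < e ->
  exists2 h0, 0 < h0 & forall h, 0 < h -> h <= h0 -> exists p q : 'rV[R]_3,
  [/\ p + q = (a + b - h) *: u, vnorm p = a, vnorm q = b &
    [/\ vnorm (p - a *: u) < e, vnorm (q - b *: u) < e & cross p q != 0]].
Proof.
move=> a0 b0 u1 e0; have d0 : 0 < 4 * (a + b) by lra.
exists (Num.min (Num.min a b) (e ^+ 2 / (4 * (a + b)))).
  by rewrite !lt_min a0 b0 divr_gt0 // exprn_gt0.
move=> h h0; rewrite !le_min => /andP[/andP[ha hb]]; rewrite ler_pdivlMr // => he.
pose W := a + b - h; have W0 : 0 < W by rewrite /W; lra.
have nW : vnorm (W *: u) = W.
  by apply: vnorm_eq; rewrite ?dotZl ?dotZr ?u1 ?mulr1 ?expr2 // ltW.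
have tri : `|a - b| <= vnorm (W *: u) <= a + b.
  by rewrite nW ler_norml /W; lra.
have [p [q [pq pa qb]]] := triangle_exists (ltW a0) (ltW b0) tri.
have est (a' b' : R) (p' q' : 'rV[R]_3) : 0 < a' -> 0 < b' -> h <= a' -> h <= b' ->
    W = a' + b' - h -> h * (4 * (a' + b')) <= e ^+ 2 ->
    p' + q' = W *: u -> vnorm p' = a' -> vnorm q' = b' -> vnorm (p' - a' *: u) < e.
  move=> a'0 b'0 ha' hb' WE he' pq' pa' qb'.
  have pu : dot p' u * (2 * W) = W ^+ 2 + a' ^+ 2 - b' ^+ 2.
    have -> : b' ^+ 2 = dot (W *: u - p') (W *: u - p').
      by rewrite -qb' vnormK -pq' addrAC subrr add0r.
    rewrite !dot_lin u1 -pa' vnormK (dotC u p').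
    by move: (dot p' u) (dot p' p') => r s; ring.
  rewrite -(ltr_pXn2r (_ : 0 < 2)%N) ?nnegrE ?vnorm_ge0 ?ltW // vnormK.
  rewrite -(ltr_pM2l W0).
  have -> : W * dot (p' - a' *: u) (p' - a' *: u) =
      2 * W * a' ^+ 2 - a' * (dot p' u * (2 * W)).
    by rewrite !dot_lin u1 (dotC u p') -vnormK pa'; ring.
  rewrite pu; apply: (@lt_le_trans _ _ (W * (h * (4 * (a' + b'))))); last first.
    by rewrite ler_pM2l.
  rewrite -subr_gt0 WE.
  have -> : (a' + b' - h) * (h * (4 * (a' + b'))) -
    (2 * (a' + b' - h) * a' ^+ 2 - a' * ((a' + b' - h) ^+ 2 + a' ^+ 2 - b' ^+ 2)) =
    h * ((a' + b' - h) * (4 * (a' + b')) - a' * (2 * b' - h)) by ring.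
  by apply: mulr_gt0 => //; nra.
have qp : q + p = W *: u by rewrite addrC.
exists p, q; split=> //; split.
- exact: (est a b p q).
- apply: (est b a q p) => //; first by rewrite /W; lra.
  by rewrite (addrC b a).
- have pq0 : p + q + (- (W *: u)) = 0 by rewrite pq subrr.
  by apply/(strict_triangleP pq0); rewrite vnormN nW pa qb /W; split; lra.
Qed.

Definition upd i u z : 'M[R]_(n, 3) := \matrix_j (if j == i then u else row j z).

Lemma row_upd i u z j : row j (upd i u z) = if j == i then u else row j z.
Proof. exact: rowK. Qed.

Lemma sum_upd i u z : \sum_j row j (upd i u z) = \sum_j row j z + (u - row i z).
Proof.
rewrite (bigD1 i) //= [in RHS](bigD1 i) //= row_upd eqxx.
rewrite (eq_bigr (fun j => row j z)); last by move=> j /negbTE ji; rewrite row_upd ji.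
by rewrite [RHS]addrC addrA subrK.
Qed.

Lemma perturb_line z e (i0 : 'I_n) : closed_polygons l z -> 0 < e ->
  exists z', [/\ closed_polygons l z', row_close e z z' &
    exists i j, cross (row i z') (row j z') != 0].
Proof.
move=> cz e0; have [[i [j ij]]|par] :=
  pselect (exists i j, cross (row i z) (row j z) != 0).
  by exists z; split=> //; [exact: row_close_refl|exists i, j].
have {}par i j : cross (row i z) (row j z) = 0.
  by apply/eqP/negPn/negP => h; apply: par; exists i, j.
have [zl z0] := (closed_polygonsP l z).1 cz.
pose u := (vnorm (row i0 z))^-1 *: row i0 z.
have u1 : dot u u = 1 by apply: normalize; rewrite -vnorm_gt0 zl.
have u0 : u != 0 by rewrite -dot_gt0 u1.
pose t i := dot (row i z) u.
have zE i : row i z = t i *: u.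
  by rewrite {1}(parallelE (v := u) (u := row i z)) ?u1 ?divr1 // crossZr par scaler0.
have nu : vnorm u = 1 by apply: vnorm_eq; rewrite ?u1 ?expr1n.
have tl i : `|t i| = l i by rewrite -zl zE vnormZ nu mulr1.
have st : \sum_i t i = 0 by rewrite -dot_suml z0 dot0l.
have [i [k [ik ti tk]]] := two_positive i0 st tl.
have [||j [m [jm tj tm]]] := @two_positive (fun i => - t i) i0.
- by rewrite sumrN st oppr0.
- by move=> x; rewrite normrN.
have nu1 : dot (- u) (- u) = 1 by rewrite dotNl dotNr opprK.
have [h1 h10 H1] := squeeze (l_gt0 i) (l_gt0 k) u1 e0.
have [h2 h20 H2] := squeeze (l_gt0 j) (l_gt0 m) nu1 e0.
pose h := Num.min h1 h2.
have h0 : 0 < h by rewrite lt_min h10.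
have [|p [q [pq pa qa [pe qe pxq]]]] := H1 h h0; first by rewrite ge_min lexx.
have [|r [s [rs ra sa [re se _]]]] := H2 h h0; first by rewrite ge_min lexx orbT.
have zi : row i z = l i *: u by rewrite zE -tl gtr0_norm.
have zk : row k z = l k *: u by rewrite zE -tl gtr0_norm.
have zj : row j z = l j *: (- u) by rewrite zE -tl -normrN gtr0_norm // scalerN scaleNr opprK.
have zm : row m z = l m *: (- u) by rewrite zE -tl -normrN gtr0_norm // scalerN scaleNr opprK.
have ne x y : 0 < t x -> 0 < - t y -> (x == y) = false.
  by move=> tx ty; apply/eqP => xy; move: ty; rewrite -xy; lra.
have [ij im kj km] := And4 (ne _ _ ti tj) (ne _ _ ti tm) (ne _ _ tk tj) (ne _ _ tk tm).
have ik' : (i == k) = false by exact: negbTE.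
have jm' : (j == m) = false by exact: negbTE.
exists (upd i p (upd k q (upd j r (upd m s z)))); split.
- apply/closed_polygonsP; split=> [x|].
    rewrite !row_upd; have [->//|_] := eqVneq x i; have [->//|_] := eqVneq x k.
    by have [->//|_] := eqVneq x j; have [->//|_] := eqVneq x m.
  rewrite !sum_upd !row_upd ik' ij im kj km jm' z0 add0r zi zk zj zm.
  transitivity (p + q + (r + s) - (l i + l k) *: u - (l j + l m) *: (- u)).
    rewrite !scalerDl !opprD !addrA; clear.
    move: (l i *: u) (l k *: u) (l j *: - u) (l m *: - u) => a b c d.
    by apply/rowP => x; rewrite !mxE; ring.
  rewrite pq rs; apply/rowP => x; rewrite !mxE; ring.
- move=> x; rewrite !row_upd; have [->|_] := eqVneq x i; first by rewrite zi.
  have [->|_] := eqVneq x k; first by rewrite zk.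
  have [->|_] := eqVneq x j; first by rewrite zj.
  have [->|_] := eqVneq x m; first by rewrite zm.
  exact: row_close_refl.
- by exists i, k; rewrite !row_upd eqxx (eq_sym k) ik' eqxx.
Qed.

Lemma dot_perp k u : dot (u - dot k u *: k) (cross k u) = 0.
Proof. by rewrite !dotE !vecE; ring. Qed.

(** The displacements for the angles t and -t have a sum along the component of x_i
orthogonal to the axis and a difference along k x x_i. These are orthogonal and
nonzero, so both displacements cannot be parallel to the same Y. *)
Lemma bend_edges z i j e : closed_polygons l z -> cross (row i z) (row j z) != 0 -> 0 < e ->
  forall Y, Y != 0 -> exists z' (delta : 'rV[R]_3),
  [/\ closed_polygons l z', row_close e z z', cross delta Y != 0 &
    [/\ row i z' = row i z + delta, row j z' = row j z - delta,
        forall x, x != i -> x != j -> row x z' = row x z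
      & cross (row i z') (row j z') != 0]].
Proof.
move=> cz ij e0 Y Y0; have [zl z0] := (closed_polygonsP l z).1 cz.
have nij : i != j by apply: contraNneq ij => ->; rewrite crossvv.
pose p := row i z + row j z.
have pz : cross p (row i z) = - cross (row i z) (row j z).
  by rewrite crossDl crossvv add0r crossC.
have p0 : p != 0 by apply: contraNneq ij => p0; rewrite -oppr_eq0 -pz p0 cross0v.
pose k := (vnorm p)^-1 *: p; have k1 : dot k k = 1 by exact: normalize.
have kz : cross k (row i z) != 0.
  by rewrite crossZl pz scaler_eq0 invr_eq0 vnorm_eq0 oppr_eq0 negb_or p0.
pose perp := row i z - dot k (row i z) *: k.
have perp0 : perp != 0.
  apply: contraNneq kz => /eqP; rewrite subr_eq0 => /eqP ->.
  by rewrite crossZr crossvv scaler0.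
pose f t := rotate_rows [set i; j]%SET k (cos t) (sin t) z.
pose delta t := rotation k (cos t) (sin t) (row i z) - row i z.
have deltaE t : delta t = (cos t - 1) *: perp + sin t *: cross k (row i z).
  rewrite /delta /rotation /perp; move: (row i z) => x.
  by apply/rowP => y; rewrite !mxE; ring.
have orth : cross perp (cross k (row i z)) != 0.
  rewrite cross_eq0 (_ : dot perp (cross k (row i z)) = 0); last first.
    exact: dot_perp.
  by rewrite expr0n mulf_eq0 !dot_eq0 negb_or perp0.
have rotp t : rotation k (cos t) (sin t) p = p.
  have pk : p = vnorm p *: k by rewrite scalerA divff ?scale1r ?vnorm_eq0.
  by have := rotation_axis (cos t) (sin t) (vnorm p) k1; rewrite -pk.
have fi t : row i (f t) = row i z + delta t.
  by rewrite row_rotate !inE eqxx /delta addrC subrK.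
have fj t : row j (f t) = row j z - delta t.
  rewrite row_rotate !inE eqxx orbT; apply: (addrI (row i z + delta t)).
  rewrite {1}/delta (addrC (row i z)) subrK -rotationD rotp.
  by rewrite -[RHS]addrA (addrC (row j z)) [in RHS]addrA /p; apply/rowP => x; rewrite !mxE; ring.
have fo t x : x != i -> x != j -> row x (f t) = row x z.
  by move=> xi xj; rewrite row_rotate !inE (negbTE xi) (negbTE xj).
have fc t : closed_polygons l (f t).
  apply/closed_polygonsP; split=> [x|].
    by rewrite row_rotate; case: ifP => _; rewrite ?rotation_norm ?cos2Dsin2.
  by rewrite -vsumT (vsum_shift _ nij (fi t) (fj t) (fo t)) !inE subrr addr0 vsumT.
have fx t : cross (row i (f t)) (row j (f t)) != 0.
  rewrite cross_eq0 !row_rotate !inE !eqxx orbT !rotation_dot ?cos2Dsin2 //.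
  by rewrite -cross_eq0.
have f0 : f 0 = z by rewrite /f cos0 sin0 rotate_rows_id.
have : \forall t \near (0 : R), forall x, vnorm (row x (f t) - row x z) < e.
  refine (@filter_forall _ _ (fun x t => vnorm (row x (f t) - row x z) < e) _
    (nbhs_filter (0 : R)) _) => x.
  have cx : continuous (fun t => vnorm (row x (f t) - row x z)).
    apply: continuous_vnorm => y t; rewrite /=.
    rewrite (_ : (fun _ => _) = fun t => f t x y - z x y); last first.
      by apply/funext => s; rewrite !mxE.
    apply: cvgB; last exact: cvg_cst.
    apply: (continuous_comp (f := f) (g := fun M : 'M[R]_(n, 3) => M x y)).
      exact: continuous_rotate.
    exact: coord_continuous.
  have : nbhs (vnorm (row x (f 0) - row x z)) [set r : R | r < e].
    by apply: open_nbhs_nbhs; split; [exact: open_lt|rewrite /= f0; exact: row_close_refl].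
  exact: (cx 0).
move=> /nbhs_ballP[r /= r0 sub].
pose t := Num.min (r / 2) 1.
have t0 : 0 < t by rewrite lt_min ltr01 andbT divr_gt0.
have tr : `|t| < r by rewrite gtr0_norm // gt_min; apply/orP; left; lra.
have tpi : t < pi.
  by apply: le_lt_trans (_ : 1 < pi); [rewrite ge_min lexx orbT|have := pi_ge2 R; lra].
have st : 0 < sin t by rewrite sin_gt0_pi // t0.
have ct : cos t - 1 != 0.
  rewrite subr_eq0; apply/eqP => c1.
  have /eqP : sin t ^+ 2 = 0 by have := cos2Dsin2 t; rewrite c1 expr1n; lra.
  by rewrite sqrf_eq0 gt_eqF.
suff [s [sr sY]] : exists s, `|s| < r /\ cross (delta s) Y != 0.
  exists (f s), (delta s); split=> //; last by split=> // x; exact: fo.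
  by apply: sub; rewrite /ball /= sub0r normrN.
have [tY|tY] := boolP (cross (delta t) Y != 0); first by exists t.
exists (- t); rewrite normrN; split=> //; apply/eqP => ntY.
move/negPn/eqP : tY => hp; move: hp ntY.
rewrite !deltaE cosN sinN !crossDl !crossZl => hp hm.
have hperp : cross perp Y = 0.
  have : (2 * (cos t - 1)) *: cross perp Y = 0.
    rewrite -[RHS]addr0 -{1}hp -hm; apply/rowP => x; rewrite !mxE; ring.
  by move/eqP; rewrite scaler_eq0 mulf_eq0 pnatr_eq0 (negbTE ct) => /eqP.
have hk : cross (cross k (row i z)) Y = 0.
  move/eqP: hp; rewrite hperp scaler0 add0r scaler_eq0 (gt_eqF st). by rewrite !crossZl => /eqP.
by case/eqP: orth; apply: (parallel_trans Y0 hperp); rewrite crossC hk oppr0.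
Qed.


(** For a partition A, B, C the condition is the same for any two of the sets,
since the three partial sums add up to 0. *)
Definition separable A B z := forall e, 0 < e -> exists z',
  [/\ closed_polygons l z', row_close e z z' & cross (vsum A z') (vsum B z') != 0].

Lemma cross_closed u v w : u + v + w = 0 -> cross u v = cross v w.
Proof.
rewrite addrC addrA => /eqP; rewrite addr_eq0 => /eqP wu.
have -> : w = - v - u by rewrite -wu addrK.
by rewrite crossDr !crossNr crossvv oppr0 add0r -crossC.
Qed.

Lemma separable_rot A B C z : partition3 A B C -> separable A B z -> separable B C z.
Proof.
move=> ABC h e e0; have [z' [cz' zz' cr]] := h e e0; exists z'; split=> //.
have [_ z0] := (closed_polygonsP l z').1 cz'.
by rewrite -(cross_closed (partition3_sum ABC z0)).
Qed.

Lemma separable_swap A B z : separable A B z -> separable B A z.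
Proof.
move=> h e e0; have [z' [cz' zz' cr]] := h e e0; exists z'; split=> //.
by rewrite crossC oppr_eq0.
Qed.

(** The sum over C does not move, so that moving the sum over A out of its
direction is enough. *)
Lemma separable_third A B C z i j : partition3 A B C -> closed_polygons l z ->
  i \in A -> j \in B -> cross (row i z) (row j z) != 0 -> vsum C z != 0 ->
  separable A B z.
Proof.
move=> ABC cz iA jB ij C0.
apply: (separable_rot (partition3_rot (partition3_rot ABC))).
apply: separable_swap => e e0.
have [AC|AC] := boolP (cross (vsum A z) (vsum C z) != 0).
  by exists z; split=> //; exact: row_close_refl.
have [z' [delta [cz' zz' dC [zi zj zo _]]]] := bend_edges cz ij e0 C0.
have nij : i != j by apply: contraNneq ij => ->; rewrite crossvv.
have hi := ABC i; have hj := ABC j.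
exists z'; split=> //; rewrite !(vsum_shift _ nij zi zj zo).
move: hi hj; rewrite iA jB.
case: (i \in B); case: (i \in C) => //= _; case: (j \in A); case: (j \in C) => //= _.
rewrite subr0 subrr !addr0 crossDl.
by move/negPn/eqP: AC => ->; rewrite add0r.
Qed.

(** If the sum over C vanishes, the pair i, j can first be used to make the other
two sums nonzero. Then m in C, which is not parallel to both i and j, takes the
place of one of them. *)
Lemma separable_pair A B C z i j m : partition3 A B C -> closed_polygons l z ->
  i \in A -> j \in B -> m \in C -> cross (row i z) (row j z) != 0 -> separable A B z.
Proof.
move=> ABC cz iA jB mC ij; have [C0|C0] := eqVneq (vsum C z) 0; last first.
  exact: (separable_third ABC cz iA jB ij C0).
have nij : i != j by apply: contraNneq ij => ->; rewrite crossvv.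
move=> e e0; have e2 : 0 < e / 2 by lra.
have [z1 [cz1 zz1 A1 ij1]] : exists z1, [/\ closed_polygons l z1, row_close (e / 2) z z1,
    vsum A z1 != 0 /\ vsum B z1 != 0 & cross (row i z1) (row j z1) != 0].
  have [_ z0] := (closed_polygonsP l z).1 cz.
  have /eqP := partition3_sum ABC z0; rewrite C0 addr0 addr_eq0 => /eqP AB.
  have [A0|A0] := eqVneq (vsum A z) 0; last first.
    exists z; split=> //; first exact: row_close_refl.
    by split=> //; rewrite -oppr_eq0 -AB.
  have zi0 : row i z != 0 by apply: contraNneq ij => ->; rewrite cross0v.
  have [z' [delta [cz' zz' dC [zi zj zo ij']]]] := bend_edges cz ij e2 zi0.
  have d0 : delta != 0 by apply: contraNneq dC => ->; rewrite cross0v.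
  exists z'; split=> //; rewrite !(vsum_shift _ nij zi zj zo) iA jB.
  have B0 : vsum B z = 0 by apply/eqP; rewrite -oppr_eq0 -AB A0.
  have := ABC i; have := ABC j; rewrite iA jB A0 B0.
  case: (i \in B); case: (i \in C) => //=; case: (j \in A); case: (j \in C) => //= _ _.
  by rewrite subr0 sub0r !add0r oppr_eq0.
suff [z2 [cz2 zz2 cr]] : exists z2,
    [/\ closed_polygons l z2, row_close (e / 2) z1 z2 & cross (vsum A z2) (vsum B z2) != 0].
  by exists z2; split=> //; rewrite [e]splitr; exact: row_close_trans zz2.
have [zl1 z01] := (closed_polygonsP l z1).1 cz1; case: A1 => A1 B1.
have m0 : row m z1 != 0 by rewrite -vnorm_gt0 zl1.
have [mi|mi] := eqVneq (cross (row m z1) (row i z1)) 0; last first.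
  have := separable_third (partition3_rot (partition3_rot ABC)) cz1 mC iA mi B1.
  by move=> /(separable_rot (partition3_rot (partition3_rot ABC))); exact.
have mj : cross (row m z1) (row j z1) != 0.
  apply: contraNneq ij1 => mj; apply/eqP; apply: (parallel_trans m0) => //.
  by rewrite crossC mi oppr0.
have BAC := partition3_swap ABC.
have := separable_third (partition3_rot (partition3_rot BAC)) cz1 mC jB mj A1.
by move=> /(separable_rot (partition3_rot (partition3_rot BAC)))/separable_swap; exact.
Qed.

(** If all pairs of edges from different sets were parallel, all edges would be,
since any two edges are both compared with one from a third set. *)
Lemma separable_noncollinear A B C z p q a b c : partition3 A B C -> closed_polygons l z ->
  a \in A -> b \in B -> c \in C -> cross (row p z) (row q z) != 0 -> separable A B z.
Proof.
move=> ABC cz aA bB cC pq; have [zl _] := (closed_polygonsP l z).1 cz.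
have BCA := partition3_rot ABC; have CAB := partition3_rot BCA.
pose cyc i j := ((i \in A) && (j \in B)) || ((i \in B) && (j \in C)) ||
  ((i \in C) && (j \in A)).
have [[i [j [ij cr]]]|no] :=
    pselect (exists i j, cyc i j /\ cross (row i z) (row j z) != 0).
  case/orP: ij => [/orP[]|] /andP[iX jY].
  - exact: (separable_pair ABC cz iX jY cC cr).
  - apply: (separable_rot CAB); apply: (separable_rot BCA).
    exact: (separable_pair BCA cz iX jY aA cr).
  - apply: (separable_rot CAB); exact: (separable_pair CAB cz iX jY bB cr).
have par i j : cyc i j || cyc j i -> cross (row i z) (row j z) = 0.
  move=> ij; apply/eqP/negPn/negP => cr; apply: no; case/orP: ij => ij.
    by exists i, j.
  by exists j, i; rewrite crossC oppr_eq0.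
(* p and q are both parallel to any edge in a set that contains neither *)
have thru r : cyc p r || cyc r p -> cyc r q || cyc q r -> False.
  move=> /par pr /par rq; case/eqP: pq; apply: (parallel_trans _ pr rq).
  by rewrite -vnorm_gt0 zl.
exfalso; have := ABC p; have := ABC q.
case pA: (p \in A); case pB: (p \in B); case pC: (p \in C) => //=;
  case qA: (q \in A); case qB: (q \in B); case qC: (q \in C) => //= _ _;
  by [apply: (thru a); rewrite /cyc aA ?pA ?pB ?pC ?qA ?qB ?qC /= ?orbT
     |apply: (thru b); rewrite /cyc bB ?pA ?pB ?pC ?qA ?qB ?qC /= ?orbT
     |apply: (thru c); rewrite /cyc cC ?pA ?pB ?pC ?qA ?qB ?qC /= ?orbT].
Qed.

Lemma separable_polygon A B C z a b c : partition3 A B C -> closed_polygons l z ->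
  a \in A -> b \in B -> c \in C -> separable A B z.
Proof.
move=> ABC cz aA bB cC e e0; have e2 : 0 < e / 2 by lra.
have [z1 [cz1 zz1 [i [j ij]]]] := perturb_line a cz e2.
have [z2 [cz2 zz2 cr]] := separable_noncollinear ABC cz1 aA bB cC ij e2.
by exists z2; split=> //; rewrite [e]splitr; exact: row_close_trans zz2.
Qed.

End Density.

(** * Regular polygons and the differentials of the diagonals *)

Section RegularPolygons.
Variables (R : realType) (n : nat) (G : half_edge_graph n) (l : 'I_n -> R).
Hypothesis n4 : (4 <= n)%N.
Hypothesis Gadm : admissible G.
Hypothesis l_gt0 : forall i, 0 < l i.
Hypothesis l_lt : forall j, l j < 2^-1 * \sum_i l i.
Implicit Types (x y : xdart G) (z : 'M[R]_(n, 3)).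

Definition nondegenerate_at x y z := xdart_src x = xdart_src y -> x != y ->
  cross (vsum (branch x) z) (vsum (branch y) z) != 0.

Lemma nondegenerate_near x y z : nondegenerate_at x y z ->
  nbhs z (nondegenerate_at x y).
Proof.
have [xy nd|xy _] := pselect (xdart_src x = xdart_src y /\ x != y); last first.
  by apply: (@filterE _ _ (nbhs_filter z)) => z' sxy nxy; case: xy.
pose f z' := dot (vsum (branch x) z') (vsum (branch x) z') *
   dot (vsum (branch y) z') (vsum (branch y) z') -
   dot (vsum (branch x) z') (vsum (branch y) z') * dot (vsum (branch x) z') (vsum (branch y) z').
have fE z' : (0 < f z') = (cross (vsum (branch x) z') (vsum (branch y) z') != 0).
  by rewrite /f -expr2 -dot_crossE dot_gt0.
have cd (I J : {set 'I_n}) : continuous (fun z' : 'M[R]_(n, 3) => dot (vsum I z') (vsum J z')).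
  by apply: continuous_dot => j; exact: continuous_vsum.
have cf : continuous f.
  move=> z'.
  exact: (cvgB (cvgM (cd _ _ z') (cd _ _ z')) (cvgM (cd _ _ z') (cd _ _ z'))).
have pos : nbhs (f z) [set r : R | 0 < r].
  by apply: open_nbhs_nbhs; split; [exact: open_gt|rewrite /= fE; exact: nd xy.1 xy.2].
apply: (@filterS _ _ (nbhs_filter z) _ _ _ (cf z _ pos)) => z' /=.
by rewrite fE => ? _ _.
Qed.

Lemma nondegenerate_dense (s : seq (xdart G * xdart G)) z e :
  closed_polygons l z -> 0 < e -> exists z', [/\ closed_polygons l z', row_close e z z' &
    forall t, t \in s -> nondegenerate_at t.1 t.2 z'].
Proof.
elim: s z e => [|[x y] s IH] z e cz e0.
  by exists z; split=> //; exact: row_close_refl.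
have e2 : 0 < e / 2 by lra.
have [z1 [cz1 zz1 nd1]] := IH _ _ cz e2.
have [[xy nxy]|no] := pselect (xdart_src x = xdart_src y /\ x != y); last first.
  exists z1; split=> //; first by apply: row_close_le zz1; lra.
  move=> t; rewrite inE => /orP[/eqP ->|]; last exact: nd1.
  by move=> xy nxy; case: no.
pose P (t : xdart G * xdart G) z' := t \in s -> nondegenerate_at t.1 t.2 z'.
have : nbhs z1 (fun z' => forall t, P t z').
  refine (@filter_forall _ _ P _ (nbhs_filter z1) _) => t.
  have [ts|ts] := boolP (t \in s); last first.
    by apply: (@filterE _ _ (nbhs_filter z1)) => z'; rewrite /P (negbTE ts).
  by apply: (@filterS _ _ (nbhs_filter z1) _ _ _ (nondegenerate_near (nd1 t ts))) => z' ? _.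
move=> /nbhs_ballP[r /= r0 sub].
have [w [wy nyw nxw]] := xdart_third Gadm xy nxy.
have part : partition3 (branch x) (branch y) (branch w).
  by move=> i; apply: branch_partition; rewrite ?wy.
have [a ax] := branch_nonempty Gadm x; have [b by_] := branch_nonempty Gadm y.
have [c cw] := branch_nonempty Gadm w.
have m0 : 0 < Num.min (e / 2) r by rewrite lt_min e2.
have [z2 [cz2 zz2 nd2]] := separable_polygon l_gt0 l_lt part cz1 ax by_ cw m0.
exists z2; split=> //.
  by rewrite [e]splitr; apply: row_close_trans zz1 _; apply: row_close_le zz2; rewrite ge_min lexx.
move=> t; rewrite inE => /orP[/eqP -> //|]; apply: sub; apply: row_close_ball => //.
by apply: row_close_le zz2; rewrite ge_min lexx orbT.
Qed.

Lemma regular_dense : dense (regular_polygons l G).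
Proof.
move=> O [p Op] oO; have [z pz _] := lambda_repr G p.
have [W oW WO] : open (@polygon_class R n l @^-1` O).
  by have /continuousP := @pi_polygon_continuous R n l; apply.
have Wz : W (\val z) by rewrite -[W _]/((set_val @^-1` W) z) WO /= -pz.
have /nbhs_ballP[e /= e0 sub] : nbhs (\val z) W by exact: open_nbhs_nbhs.
have [z' [cz' zz' nd]] :=
  nondegenerate_dense (enum {: xdart G * xdart G}) (set_mem (valP z)) e0.
exists (polygon_class (exist _ z' (mem_set cz'))); split.
  have : W z' by apply: sub; exact: row_close_ball.
  by rewrite -[W _]/((set_val @^-1` W) (exist _ z' (mem_set cz'))) WO.
apply: cross_regular => // x y; apply: (nd (x, y)).
by rewrite mem_enum.
Qed.

Lemma regular_open : open (regular_polygons l G).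
Proof.
have /continuousP h := @lambda_continuous R n G l.
by apply: h; exact: open_interior.
Qed.

Lemma regular_lambda_gt0 (p : polygon_space l) (a : iedge G) :
  regular_polygons l G p -> 0 < lambda G p a.
Proof.
by move=> /(interior_triangle_strict Gadm n4) /(triangle_strict_gt0 Gadm) /(_ (inl a)).
Qed.

Lemma regular_nonvanishing : regular_polygons l G `<=` nonvanishing_polygons l G.
Proof.
move=> p pr; split=> [[z [u u0 zu] zp]|a]; last by rewrite gt_eqF // regular_lambda_gt0.
have i0 : 'I_n := Ordinal (leq_trans (isT : 0 < 4)%N n4).
have [x [y [_ [xv yv _ [xy _ _]]]]] := xdart_srcP Gadm (hend G i0).
have line I : cross (vsum I (\val z)) u = 0.
  rewrite /vsum; elim/big_rec: _ => [|i v _ IH]; first exact: cross0v.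
  by have [t ->] := zu i; rewrite crossDl IH crossZl crossvv scaler0 addr0.
rewrite -zp in pr; have /eqP := regular_cross Gadm n4 pr (etrans xv (esym yv)) xy.
by apply; apply: (parallel_trans u0 (line _)); rewrite crossC line oppr0.
Qed.

Definition length_form (a : iedge G) z (v : 'M[R]_(n, 3)) : R^o :=
  (vnorm (vsum (half_edges_behind a) z))^-1 *
  dot (vsum (half_edges_behind a) z) (vsum (half_edges_behind a) v).

Lemma vsum_linear I (c : R) (u v : 'M[R]_(n, 3)) :
  vsum I (c *: u + v) = c *: vsum I u + vsum I v.
Proof.
rewrite /vsum scaler_sumr -big_split; apply: eq_bigr => i _.
by rewrite linearP.
Qed.

Lemma length_form_linear a z : linear (length_form a z).
Proof.
move=> c u v; rewrite /length_form vsum_linear dotDr dotZr mulrDr.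
by congr (_ + _); rewrite mulrCA.
Qed.

HB.instance Definition _ a z := GRing.isLinear.Build R 'M[R]_(n, 3) R^o _
  (length_form a z) (length_form_linear a z).

Lemma coadD xi (u v : 'rV[R]_3) : coad xi (u + v) = coad xi u + coad xi v.
Proof. by rewrite !coadE !su2_bracketE; apply: row3P; rewrite !mxE /=; ring. Qed.

Lemma coad0 (xi : 'rV[R]_3) : coad xi 0 = 0.
Proof. by rewrite !coadE !su2_bracketE; apply: row3P; rewrite !mxE /=; ring. Qed.

Lemma dot_coad xi (u : 'rV[R]_3) : dot u (coad xi u) = 0.
Proof. by rewrite dotE coadE su2_bracketE !mxE /=; ring. Qed.

Lemma vsum_inf_coAd I z xi : vsum I (inf_coAd z xi) = coad xi (vsum I z).
Proof.
rewrite /vsum (big_morph _ (coadD xi) (coad0 xi)).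
by apply: eq_bigr => i _; rewrite rowK.
Qed.

Lemma length_form_orbit a z v : v \in orbit_tangent z -> length_form a z v = 0.
Proof.
by move=> /orbit_tangentP[xi ->]; rewrite /length_form vsum_inf_coAd dot_coad mulr0.
Qed.

(** With m = |Y|, N = |Y + h| and s = <Y, h>, the error is (m N - m^2 - s) / m. It is
nonnegative by Cauchy-Schwarz, and 2 (m N - m^2 - s) = |h|^2 - (N - m)^2. *)
Lemma vnorm_expansion (Y h : 'rV[R]_3) : Y != 0 ->
  `|vnorm (Y + h) - vnorm Y - (vnorm Y)^-1 * dot Y h| <= (2 * vnorm Y)^-1 * dot h h.
Proof.
move=> Y0; have m0 : 0 < vnorm Y by rewrite vnorm_gt0.
have cs := dot_le Y (Y + h); have := vnormK (Y + h).
rewrite dot_add; rewrite dotDr in cs; rewrite -vnormK in cs *.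
move: m0 cs; move: (vnorm Y) (vnorm (Y + h)) (dot Y h) (dot h h) => m N s q m0 cs hN.
have -> : N - m - m^-1 * s = (m * N - m ^+ 2 - s) / m by field; rewrite gt_eqF.
rewrite ger0_norm; last by apply: divr_ge0; [lra|exact: ltW].
rewrite ler_pdivrMr //.
have -> : (2 * m)^-1 * q * m = q / 2 by field; rewrite gt_eqF.
by have := sqr_ge0 (N - m); nra.
Qed.

Lemma coord_le_norm (M : 'M[R]_(n, 3)) i j : `|M i j| <= `|M|.
Proof.
by rewrite [leRHS]/Num.norm /= mx_normrE; apply/bigmax_geP; right; exists (i, j).
Qed.

Lemma dot_vsum_le I (M : 'M[R]_(n, 3)) :
  dot (vsum I M) (vsum I M) <= 3 * (n%:R * `|M|) ^+ 2.
Proof.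
have b j : vsum I M 0 j ^+ 2 <= (n%:R * `|M|) ^+ 2.
  rewrite -[leLHS]real_normK ?num_real // ler_pXn2r ?nnegrE ?mulr_ge0 //.
  rewrite /vsum summxE; apply: le_trans (ler_norm_sum _ _ _) _.
  apply: (@le_trans _ _ (\sum_(i < n) `|M|)); last first.
    by rewrite sumr_const card_ord mulr_natl.
  rewrite big_mkcond; apply: ler_sum => i _; case: ifP => // _.
  by rewrite mxE coord_le_norm.
rewrite dotE -!expr2; have := b 0; have := b 1; have := b 2%:R.
by move: (n%:R * _) => t; lra.
Qed.

Lemma length_form_differential (z : closed_polygons l) a :
  vsum (half_edges_behind a) (\val z) != 0 ->
  forall e : R, 0 < e -> \forall w \near z,
    `|lambda G (polygon_class w) a - lambda G (polygon_class z) a -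
      length_form a (\val z) (\val w - \val z)| <= e * `|\val w - \val z|.
Proof.
move=> Y0 e e0; set Y := vsum _ _ in Y0.
have m0 : 0 < vnorm Y by rewrite vnorm_gt0.
have n0 : 0 < n%:R :> R by rewrite ltr0n (leq_trans _ n4).
(* chosen so that 3 (n |M|)^2 / (2 |Y|) <= e |M| whenever |M| < r *)
pose r := 2 * vnorm Y * e / (3 * n%:R ^+ 2).
have d0 : 0 < 3 * n%:R ^+ 2 :> R by rewrite mulr_gt0 // exprn_gt0.
have r0 : 0 < r by rewrite divr_gt0 // !mulr_gt0.
have near_z : nbhs z (@set_val _ (closed_polygons l) @^-1` ball (\val z) r).
  by apply: (initial_continuous (f := @set_val _ (closed_polygons l))); exact: nbhsx_ballx.
apply: filterS near_z => w /= wz.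
have hw : `|\val w - \val z| < r.
  by move: wz; rewrite -ball_normE /= distrC.
rewrite !lambdaE !diagonal_lengthE /length_form -/Y.
set M := \val w - \val z.
have -> : vsum (half_edges_behind a) (\val w) = Y + vsum (half_edges_behind a) M.
  by rewrite /M -[_ - _]addrC -scaleN1r vsum_linear scaleN1r addrA subrr add0r.
apply: le_trans (vnorm_expansion _ Y0) _.
apply: le_trans (ler_wpM2l _ (dot_vsum_le _ _)) _; first by rewrite invr_ge0 mulr_ge0 // ltW.
have [M0|M0] := eqVneq `|M| 0; first by rewrite M0 !mulr0 expr0n !mulr0.
have M1 : 0 < `|M| by rewrite lt0r M0 normr_ge0.
rewrite ler_pdivrMl ?mulr_gt0 //.
move: hw; rewrite -/M /r ltr_pdivlMr // => hw.
rewrite exprMn; have : `|M| * (`|M| * (3 * n%:R ^+ 2)) <= `|M| * (2 * vnorm Y * e).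
  by rewrite ler_pM2l // ltW.
by congr (_ <= _); ring.
Qed.

End RegularPolygons.

(** * Linear independence of the differentials *)

Section Independence.
Variables (R : realType) (n : nat) (G : half_edge_graph n).
Hypothesis Gadm : admissible G.
Implicit Types (x y : xdart G) (z : 'M[R]_(n, 3)) (a : iedge G).

(** P below jumps by c_a Y_a across the edge a and is parallel to x_i at the end of
the half-edge i. By induction P vanishes at the target of each dart d: for each
of the two darts that follow d, the value of P at the common vertex is the jump,
hence parallel to its diagonal, and the two diagonals are independent. *)
Lemma tree_potential z (c : iedge G -> R) (mu : 'rV[R]_3) (tau : 'I_n -> R) :
  \sum_i row i z = 0 -> (forall x y, nondegenerate_at x y z) ->
  (forall i, \sum_(a | i \in half_edges_behind a) c a *: vsum (half_edges_behind a) z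
     = mu + tau i *: row i z) ->
  forall a, c a *: vsum (half_edges_behind a) z = 0.
Proof.
move=> z0 nd H; pose Y a := vsum (half_edges_behind a) z.
pose P v : 'rV[R]_3 := \sum_(a | behind a v) c a *: Y a - mu.
have Phalf i : P (hend G i) = tau i *: row i z.
  rewrite /P (eq_bigl (fun a => i \in half_edges_behind a)).
    by rewrite H addrAC subrr add0r.
  by move=> a; rewrite inE.
have Pedge a : P (src a) - P (tgt a) = c a *: Y a.
  rewrite /P opprB addrA subrK big_mkcond [X in _ - X]big_mkcond /=.
  rewrite (bigD1 a) //= [X in _ - X](bigD1 a) //= behind_src behind_tgt // add0r.
  rewrite -addrA [X in _ + X](_ : _ = 0) ?addr0 //; apply/eqP; rewrite subr_eq0; apply/eqP.
  by apply: eq_bigr => b ba; rewrite behind_other.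
have Ydart d : vsum (branch (inl d)) z = (if d.2 then -1 else 1) *: Y d.1.
  case: d => a b; rewrite branch_behind //=; case: b; last by rewrite scale1r.
  rewrite scaleN1r; apply/eqP; rewrite -addr_eq0 addrC.
  by rewrite vsum_setC z0.
have Pdart d : P (dart_src d) - P (dart_tgt d) = - (c d.1 *: vsum (branch (inl d)) z).
  rewrite Ydart; case: d => a []; rewrite /dart_src /dart_tgt [_.1]/= [_.2]/=.
    by rewrite Pedge scaleN1r scalerN opprK.
  by rewrite scale1r -Pedge [RHS]opprB.
have Ptgt d : P (dart_tgt d) = 0.
  elim/(dart_ind Gadm): d => d IH.
  have [x [y [xy dx dy _]]] := succ_xdartP Gadm d.
  have par w : succ_xdart (inl d) w -> cross (P (dart_tgt d)) (vsum (branch w) z) = 0.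
    move=> dw; rewrite -(succ_xdart_src dw); case: w dw => [e|i] dw /=.
      have := Pdart e; rewrite (IH e dw) subr0 => ->.
      by rewrite crossNl crossZl crossvv scaler0 oppr0.
    by rewrite Phalf branch_half vsum_set1 crossZl crossvv scaler0.
  have xy' : xdart_src x = xdart_src y.
    by rewrite (succ_xdart_src dx) (succ_xdart_src dy).
  have ndxy := nd x y xy' xy; apply/eqP; apply: contraTT ndxy => P0.
  rewrite negbK; apply/eqP; apply: (parallel_trans P0); last exact: par.
  by rewrite crossC par ?oppr0.
move=> a; rewrite -[_ *: _]Pedge.
by have := Ptgt (a, true); have := Ptgt (a, false); rewrite /dart_tgt /= => -> ->; rewrite subrr.
Qed.

End Independence.

Section Multipliers.
Variables (R : realType) (n : nat) (z : 'M[R]_(n, 3)).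

Lemma row_form_coord m (f : 'rV[R]_m -> R) (u : 'rV[R]_m) :
  (forall c u v, f (c *: u + v) = c * f u + f v) ->
  f u = \sum_k u 0 k * f (delta_mx 0 k).
Proof.
move=> lin; have f0 : f 0 = 0.
  by have := lin 1 0 0; rewrite scale1r addr0 mul1r => /eqP; rewrite -subr_eq subrr eq_sym => /eqP.
rewrite [in LHS](row_sum_delta u); elim/big_rec2: _ => [//|k a v _ <-].
by rewrite lin.
Qed.

(** Psi vanishes on the kernel of the differential D of the constraints, so it
factors through D, with Psi after a section of D as the other factor. *)
Lemma lagrange (Psi : 'Hom('M[R]_(n, 3), R^o)) :
  (forall v, v \in tangent z -> Psi v = 0) ->
  exists (mu : 'rV[R]_3) (tau : 'I_n -> R), forall v,
    Psi v = dot mu (\sum_i row i v) + \sum_i tau i * dot (row i z) (row i v).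
Proof.
move=> h; pose D := linfun (dconstraint z).
pose g := (Psi \o D^-1)%VF.
have gD v : Psi v = g (D v).
  have : v - (D^-1)%VF (D v) \in tangent z.
    by rewrite memv_ker linearB /= limg_lfunVK ?subrr // memv_img ?memvf.
  by move=> /h; rewrite linearB /= => /eqP; rewrite subr_eq0 comp_lfunE => /eqP.
pose g1 (s : 'rV[R]_3) : R := g (s, 0); pose g2 (t : 'rV[R]_n) : R := g (0, t).
have lin1 c u v : g1 (c *: u + v) = c * g1 u + g1 v.
  rewrite -[RHS](linearP g c (u, 0) (v, 0)) /g1; congr (g _).
  by rewrite [RHS](_ : _ = (c *: u + v, c *: 0 + 0)) // scaler0 addr0.
have lin2 c u v : g2 (c *: u + v) = c * g2 u + g2 v.
  rewrite -[RHS](linearP g c (0, u) (0, v)) /g2; congr (g _).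
  by rewrite [RHS](_ : _ = (c *: 0 + 0, c *: u + v)) // scaler0 addr0.
exists (\row_k g1 (delta_mx 0 k)), (fun i => g2 (delta_mx 0 i)) => v.
have DE : D v = dconstraint z v by rewrite lfunE.
rewrite gD DE /dconstraint.
have -> : (\sum_i row i v, \row_i su2_dot (row i z) (row i v)) =
    (\sum_i row i v, 0) + (0, \row_i su2_dot (row i z) (row i v)) :> ('rV[R]_3 * 'rV[R]_n)%type.
  by rewrite [RHS](_ : _ = (\sum_i row i v + 0, 0 + \row_i su2_dot (row i z) (row i v))) //
    addr0 add0r.
rewrite linearD /= -/(g1 _) -/(g2 _) (row_form_coord _ lin1) (row_form_coord _ lin2).
congr (_ + _).
  by rewrite dotE sumI3 !mxE; congr (_ + _ + _); exact: mulrC.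
by apply: eq_bigr => i _; rewrite mxE dot.unlock mulrC.
Qed.

End Multipliers.

Section Main.
Variables (R : realType) (n : nat) (G : half_edge_graph n) (l : 'I_n -> R).
Hypothesis n4 : (4 <= n)%N.
Hypothesis Gadm : admissible G.

Lemma length_forms_free (z : closed_polygons l) (c : iedge G -> R) :
  regular_polygons l G (polygon_class z) ->
  (forall v, v \in tangent (\val z) -> \sum_a c a * length_form a (\val z) v = 0) ->
  forall a, c a = 0.
Proof.
move=> zr h; set x := \val z in h *.
have [zl z0] := (closed_polygonsP l x).1 (set_mem (valP z)).
pose Y (a : iedge G) := vsum (half_edges_behind a) x.
have Y0 (a : iedge G) : 0 < vnorm (Y a).
  by have := regular_lambda_gt0 n4 Gadm a zr; rewrite lambdaE diagonal_lengthE.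
pose Psi : 'Hom('M[R]_(n, 3), R^o) := \sum_a c a *: linfun (length_form a x).
have PsiE v : Psi v = \sum_a c a * length_form a x v.
  by rewrite sum_lfunE; apply: eq_bigr => a _; rewrite scale_lfunE lfunE.
have [|mu [tau H]] := @lagrange R n x Psi; first by move=> v /h; rewrite PsiE.
have nd (u v : xdart G) : nondegenerate_at u v x.
  by move=> uv nuv; exact: regular_cross.
have Hi i : \sum_(a | i \in half_edges_behind a) (c a / vnorm (Y a)) *: Y a =
    mu + tau i *: row i x.
  apply/rowP => j; pose v : 'M[R]_(n, 3) := \matrix_k (if k == i then delta_mx 0 j else 0).
  have vs I : vsum I v = if i \in I then delta_mx 0 j else 0.
    rewrite /vsum (eq_bigr (fun k => if k == i then delta_mx 0 j else 0)); last first.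
      by move=> k _; rewrite rowK.
    exact: sum_single.
  have := H v; rewrite PsiE.
  have -> : \sum_k row k v = delta_mx 0 j.
    by rewrite -vsumT vs inE.
  rewrite (bigD1 i) //= [X in _ = _ + (_ + X)]big1 ?addr0; last first.
    by move=> k /negbTE ki; rewrite rowK ki dotC dot0l mulr0.
  rewrite rowK eqxx !dot_delta [row i x 0 j]mxE => e.
  rewrite !mxE summxE -[in RHS]e big_mkcond /=.
  apply: eq_bigr => a _; rewrite /length_form vs; case: ifP => _.
    by rewrite dot_delta !mxE -mulrA.
  by rewrite dotC dot0l !mulr0.
move=> a; have /eqP := tree_potential Gadm z0 nd Hi a.
rewrite scaler_eq0 -vnorm_eq0 -/(Y a) (gt_eqF (Y0 a)) orbF.
by rewrite mulf_eq0 invr_eq0 (gt_eqF (Y0 a)) orbF => /eqP.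
Qed.

Lemma lengths_independent (z : closed_polygons l) :
  regular_polygons l G (polygon_class z) ->
  exists2 d : iedge G -> 'Hom(subvs_of (tangent (\val z)), R^o),
    forall a, is_differential (fun p => lambda G p a) z (d a)
    & free [seq d a | a : iedge G].
Proof.
move=> zr; pose psi (a : iedge G) := linfun (length_form a (\val z)) : 'Hom('M[R]_(n, 3), R^o).
pose d (a : iedge G) : 'Hom(subvs_of (tangent (\val z)), R^o) := (psi a \o linfun vsval)%VF.
have dE a u : d a u = length_form a (\val z) (vsval u).
  by rewrite comp_lfunE !lfunE.
exists d => [a|].
  split=> [u hu|]; first by rewrite dE length_form_orbit.
  exists (psi a) => [u|e e0]; first by rewrite dE lfunE.
  have Y0 : vsum (half_edges_behind a) (\val z) != 0.
    by rewrite -vnorm_gt0 -diagonal_lengthE -lambdaE; exact: regular_lambda_gt0.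
  have := length_form_differential n4 Y0 e0; apply: filterS => w.
  by rewrite lfunE.
have -> : [seq d a | a : iedge G] = codom_tuple d by [].
apply/freeP => k hk i.
suff kv v : v \in tangent (\val z) ->
    \sum_a k (enum_rank a) * length_form a (\val z) v = 0.
  by have := @length_forms_free z (fun a => k (enum_rank a)) zr kv (enum_val i);
    rewrite enum_valK.
move=> vt.
have := congr1 (fun f : 'Hom(_, _) => f (vsproj (tangent (\val z)) v)) hk.
rewrite /= sum_lfunE zero_lfunE => h.
rewrite -[RHS]h (reindex (@enum_val _ (iedge G))) /=; last first.
  by exists enum_rank => a _; [exact: enum_valK|exact: enum_rankK].
apply: eq_bigr => j _; rewrite scale_lfunE nth_codom dE vsprojK // enum_valK.
by [].
Qed.

End Main.

Theorem theorem4p1 (R : realType) (n : nat) (G : half_edge_graph n)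
    (l : 'I_n -> R) :
  (4 <= n)%N -> admissible G -> (forall i, 0 < l i) ->
  (forall j, l j < 2^-1 * \sum_i l i) ->
  [/\ range (@lambda R n l G) = Delta_l l G,
      forall d, connected (@lambda R n l G @^-1` [set d]),
      open (regular_polygons l G) /\ dense (regular_polygons l G),
      regular_polygons l G `<=` nonvanishing_polygons l G
    & forall z : closed_polygons l, regular_polygons l G (polygon_class z) ->
        exists2 d : iedge G -> 'Hom(subvs_of (tangent (\val z)), R^o),
          forall a, is_differential (fun p => lambda G p a) z (d a)
          & free [seq d a | a : iedge G]].
Proof.
move=> n4 Gadm l_gt0 l_lt; split.
- apply/seteqP; split=> [_ [p _ <-]|d]; first exact: lambda_Delta.
  by move=> /(Delta_lambda Gadm n4)[p <-]; exists p.
- by move=> d; exact: lambda_fiber_connected.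
- by split; [exact: regular_open|exact: regular_dense].
- exact: regular_nonvanishing.
- by move=> z; exact: lengths_independent.
Qed.
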